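(* Let $\Omega$ be an open bounded subset of $\mathbb{R}^2$ with Lipschitz boundary. Assume that $F:\mathcal{K}^2\to[0,+\infty)$ satisfies the following conditions. (H1) Domain monotonicity: for all $\Omega_1,\Omega_2\in\mathcal{K}^2$, $\Omega_1\subseteq\Omega_2$ implies $F(\Omega_1)\ge F(\Omega_2)$. (H2) Homogeneity: there exists $\alpha>0$ such that $F(tK)=t^{-\alpha}F(K)$ for every $t>0$ and every $K\in\mathcal{K}^2$. (H3) Behaviour on polygons: setting, for every integer $n\ge 3$, $$\gamma(n):=\min\{F(P)\,|P|^{\alpha/2} : P \text{ an } n\text{-gon in } \mathcal{K}^2\},$$ one has (i) $\gamma(6)=F(H)$; (ii) for every $k\in\mathbb{N}$ and all integers $n_1,\dots,n_k\ge 3$, $$\frac1k\sum_{i=1}^k n_i\le 6\ \Longrightarrow\ \frac1k\sum_{i=1}^k\gamma(n_i)^{2/\alpha}\ge\gamma(6)^{2/\alpha}.$$ For $k\in\mathbb{N}$ let $$M_k(\Omega)=\inf\Big\{\max_{i=1,\dots,k}F(E_i) : \{E_i\}\in\mathcal{C}_k(\Omega)\Big\}.$$ Then $$\lim_{k\to+\infty}\frac{|\Omega|^{\alpha/2}}{k^{\alpha/2}}\,M_k(\Omega)=F(H).$$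
   Context: $\mathcal{K}^2$ is the family of convex bodies in $\mathbb{R}^2$, i.e. convex compact subsets of the plane with nonempty interior. $|\cdot|$ denotes area (Lebesgue measure). $H$ is the regular hexagon of unit area. An $n$-gon in $\mathcal{K}^2$ is a convex polygon with $n$ sides. $\mathcal{C}_k(\Omega)$ is the class of convex $k$-clusters of $\Omega$: families $\{E_i\}_{i=1,\dots,k}$ of subsets of $\mathbb{R}^2$ such that $E_i\in\mathcal{K}^2$ for every $i$, $E_i\subseteq\Omega$ for every $i$, and $|E_i\cap E_j|=0$ for every $i\ne j$.
   Formalization: Since F is not assumed translation invariant, (H3)(i) is required for every translate of the unit-area regular hexagon H, i.e. F(H) does not depend on where H is placed; for one fixed position the claim is false. Ω is taken nonempty. *)

(* Defs.v *)
From HB Require Import structures.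
From mathcomp Require Import all_boot all_order all_algebra.
From mathcomp Require Import all_classical all_reals all_analysis.
Set Implicit Arguments.
Unset Strict Implicit.
Unset Printing Implicit Defensive.
Import Order.TTheory GRing.Theory Num.Theory numFieldNormedType.Exports.
Local Open Scope classical_set_scope.
Local Open Scope ring_scope.

(* R * R carries the product topology; its library norm is the sup norm, which
   induces the Euclidean topology, and only the topology is used below. *)
Notation plane R := (R * R)%type.

Section Plane.
Context {R : realType}.
Implicit Types (K P H S Omega : set (plane R)) (F : set (plane R) -> R).

Definition dot (u v : plane R) : R := u.1 * v.1 + u.2 * v.2.

Definition leb2 :
    set (measurableTypeR R * measurableTypeR R)%type -> \bar R :=
  (lebesgue_measure \x lebesgue_measure)%E.

(* Used only on bounded Borel sets, whose measure is finite. *)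
Definition area K : R := fine (leb2 K).

Definition convex K : Prop := @convex_set R (plane R) K.

Definition conv_hull (A : set (plane R)) : set (plane R) := smallest convex A.

Definition convex_body K : Prop := [/\ convex K, compact K & K° !=set0].

Definition dilate (t : R) K : set (plane R) := [set t *: x | x in K].

(* A functional F need not be translation invariant; F(H) for "the" regular
   hexagon H of unit area presupposes that F is constant on translates of H. *)
Definition translate (v : plane R) K : set (plane R) := [set v + x | x in K].

Definition convex_polygon P : Prop :=
  convex_body P /\ exists2 V, finite_set V & P = conv_hull V.

(* A side is the contact set of P with a supporting line, when that set is
   not reduced to a single point. *)
Definition is_side P S : Prop :=
  exists u : plane R, exists c : R,
    [/\ u != 0, forall x, P x -> dot u x <= c,
        S = [set x | P x /\ dot u x = c]
      & exists x y, [/\ S x, S y & x <> y]].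

Definition is_ngon (n : nat) P : Prop :=
  convex_polygon P /\ ([set S | is_side P S] #= `I_n)%card.

(* c, rho and theta range over all centers, circumradii and orientations. *)
Definition regular_hexagon H : Prop :=
  exists (c : plane R) (rho theta : R), 0 < rho /\
    H = conv_hull [set c + rho *: (cos (theta + j%:R * (pi / 3)),
                                   sin (theta + j%:R * (pi / 3)))
                  | j in `I_6].

(* Near each boundary point x, in Cartesian coordinates (s, t) with origin x
   and orthonormal axes e and (- e.2, e.1), the set Omega is the strict
   epigraph of a Lipschitz function. *)
Definition lipschitz_boundary Omega : Prop :=
  forall x, (closure Omega `\` Omega°) x ->
    exists (r : R) (e : plane R) (g : R -> R),
      [/\ 0 < r, dot e e = 1, [lipschitz g s | s in setT]
        & forall s t : R, `|s| < r -> `|t| < r ->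
            (Omega (x + s *: e + t *: (- e.2, e.1)) <-> g s < t)].

Definition convex_cluster (k : nat) Omega (E : 'I_k -> set (plane R)) : Prop :=
  [/\ forall i, convex_body (E i), forall i, E i `<=` Omega
    & forall i j, i != j -> leb2 (E i `&` E j) = 0%E].

(* F is nonnegative on convex bodies, so for k > 0 the default value 0 of the
   iterated maximum does not matter; for nonempty open Omega and k > 0 the
   real infimum is taken over a nonempty set bounded below by 0. *)
Definition M_inf F Omega (k : nat) : R :=
  inf [set \big[Num.max/0]_(i < k) F (E i)
      | E in [set E : 'I_k -> set (plane R) | convex_cluster Omega E]].

Definition is_min (A : set R) (m : R) : Prop := A m /\ lbound A m.

End Plane.

(* Main.v *)
Require Import Defs.
From HB Require Import structures.
From mathcomp Require Import all_boot all_order all_algebra.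
From mathcomp Require Import all_classical all_reals all_analysis.
From mathcomp Require Import measurable_realfun ring lra zify.
Set Implicit Arguments.
Unset Strict Implicit.
Unset Printing Implicit Defensive.
Import Order.TTheory GRing.Theory Num.Theory numFieldNormedType.Exports.
Local Open Scope classical_set_scope.
Local Open Scope ring_scope.

(** Write [g n] for [gamma n `^ (2 / alpha)], [A] for the area of [Omega] and [m']
    for the power [2 / alpha] of the maximum of [F] on a cluster.  Raised to this
    power the claim says that the optimal [m'] is asymptotic to [g 6 * k / A].

    Upper bound.  Translates of a small hexagon [delta H] tile the plane, so about
    [A / delta ^ 2] of them fit into [Omega] ([hexagon_packing]); by homogeneity
    and because [F] takes the same value [gamma 6] on all translates of [H], such a
    cluster has [m' = g 6 / delta ^ 2].

    Lower bound.  The geometric core is [cluster_polygons]: [K] convex bodies with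
    disjoint interiors in a square can be enlarged to convex polygons, still with
    disjoint interiors in the square, that have at most [6 K + 24] sides in all.
    Monotonicity and the definition of [gamma] bound [g (n i)] by [m'] times the
    area of the [i]-th polygon, of which [n i] is the number of sides; summing, and
    adding eight triangles to bring the average number of sides down to 6, the
    convexity hypothesis on [gamma] gives [(K + 8) * g 6 <= m' * area + 8 * g 3]
    ([cluster_bound]).  This concerns a convex container.  For [Omega] itself, put
    it in a square and fill the rest of the square with hexagons that have the
    same value of [F]: they use up the area of the rest of the square at the optimal
    rate, so that only the area of [Omega] remains in the bound.  The rest of the
    square has the right area because a Lipschitz boundary has area zero
    ([lipschitz_boundary_null]).

    The polygons come from a maximal family of disjoint open convex sets containing
    the interiors of the bodies ([maximal_packing]), and their sides are counted
    without planar graphs.  Choose a vertical direction in general position.  By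
    maximality, each side of a set of the family comes from a line that separates it
    from a vertical neighbour, a set directly above or below it on some vertical
    line ([maximal_packing_polygons]).  Sweep a vertical line across the family.  A
    new pair of neighbours appears only when a set starts, and then there are at
    most two of them, or when a set ends, and then there is at most one: with [N]
    sets there are at most [3 N] pairs of neighbours ([line_consecutive_le]), hence
    at most [6 N] sides.  Here [N = K + 4], since four sets are needed to fence in
    the square. *)

(** * Convexity and openness in coordinates *)

Section Basics.
Context {R : realType}.
Implicit Types (A B O : set (plane R)) (p q u v : plane R).

Lemma convexP A : convex A <->
  (forall p q (t : R), A p -> A q -> 0 <= t -> t <= 1 -> A (p + t *: (q - p))).
Proof.
split=> [cA p q t Ap Aq t0 t1|cA p q t /set_mem Ap /set_mem Aq].
  have := cA q p (Itv01 t0 t1) (mem_set Aq) (mem_set Ap) => /set_mem.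
  by rewrite /conv/= /unstable.onem scalerBl scale1r scalerBr addrCA addrA.
apply/mem_set; rewrite /conv/= /unstable.onem.
have t0 : 0 <= t%:num by []. have t1 : t%:num <= 1 by []. have := cA q p t%:num Aq Ap t0 t1.
by rewrite scalerBl scale1r scalerBr addrCA addrA.
Qed.

Lemma openP A : open A <->
  (forall p, A p -> exists2 e : R, 0 < e &
     forall q, `|q.1 - p.1| < e -> `|q.2 - p.2| < e -> A q).
Proof.
rewrite openE; split=> [oA p Ap|oA p Ap].
  have /nbhs_ballP[e /= e0 be] := oA p Ap.
  exists e => // q q1 q2; apply: be; split => /=.
    by rewrite /ball /= distrC.
  by rewrite /ball /= distrC.
have [e e0 be] := oA p Ap.
apply/nbhs_ballP; exists e => //= q [/= q1 q2]; apply: be.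
  by rewrite distrC.
by rewrite distrC.
Qed.


Lemma plane_coordE : (forall p q : plane R, (p + q).1 = p.1 + q.1)
  * (forall p q : plane R, (p + q).2 = p.2 + q.2)
  * (forall p : plane R, (- p).1 = - p.1) * (forall p : plane R, (- p).2 = - p.2)
  * (forall t (p : plane R), (t *: p).1 = t * p.1)
  * (forall t (p : plane R), (t *: p).2 = t * p.2)
  * ((0 : plane R).1 = 0) * ((0 : plane R).2 = 0).
Proof. by []. Qed.

Lemma plane_eqP p q : p = q <-> p.1 = q.1 /\ p.2 = q.2.
Proof. by split=> [->//|]; case: p q => [a b] [c d] /= [-> ->]. Qed.

Lemma dotDr u p q : dot u (p + q) = dot u p + dot u q.
Proof. by rewrite /dot !plane_coordE; ring. Qed.

Lemma dotNr u p : dot u (- p) = - dot u p.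
Proof. by rewrite /dot !plane_coordE; ring. Qed.

Lemma dotZr u t p : dot u (t *: p) = t * dot u p.
Proof. by rewrite /dot !plane_coordE; ring. Qed.

Lemma dotNl u p : dot (- u) p = - dot u p.
Proof. by rewrite /dot !plane_coordE; ring. Qed.

Lemma dotZl u t p : dot (t *: u) p = t * dot u p.
Proof. by rewrite /dot !plane_coordE; ring. Qed.

Definition dotE := (dotDr, dotNr, dotZr, dotNl, dotZl).

Definition perp u : plane R := (- u.2, u.1).

Lemma perpE : (forall u, (perp u).1 = - u.2) * (forall u, (perp u).2 = u.1).
Proof. by []. Qed.

Lemma dot_perp u : dot u (perp u) = 0.
Proof. by rewrite /dot /=; ring. Qed.

Lemma plane_neq0 u : (u != 0) = (u.1 != 0) || (u.2 != 0).
Proof.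
case: u => a b; rewrite -negb_and; congr (~~ _).
Qed.

Lemma dot_gt0 u : u != 0 -> 0 < dot u u.
Proof.
rewrite plane_neq0 /dot => /orP[] h.
  rewrite ltr_wpDr// ?lt_def; first by rewrite -expr2 sqr_ge0.
  by rewrite -expr2 sqr_ge0 sqrf_eq0 h.
rewrite ltr_wpDl// ?lt_def; first by rewrite -expr2 sqr_ge0.
by rewrite -expr2 sqr_ge0 sqrf_eq0 h.
Qed.

Lemma dot0_perp u v : u != 0 -> dot u v = 0 -> exists t, v = t *: perp u.
Proof.
move=> /dot_gt0 u0 uv; exists (dot (perp u) v / dot u u).
have {}u0 : dot u u != 0 by rewrite gt_eqF.
apply/plane_eqP; move: uv u0; rewrite !plane_coordE /dot /= => uv u0.
split.
  apply: (mulIf u0); rewrite mulrAC divfK//.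
  have -> : v.1 * (u.1 * u.1 + u.2 * u.2) =
     u.1 * (u.1 * v.1 + u.2 * v.2) + u.2 * (u.2 * v.1 - u.1 * v.2) by ring.
  by rewrite uv; ring.
apply: (mulIf u0); rewrite mulrAC divfK//.
have -> : v.2 * (u.1 * u.1 + u.2 * u.2) =
   u.2 * (u.1 * v.1 + u.2 * v.2) + u.1 * (u.1 * v.2 - u.2 * v.1) by ring.
by rewrite uv; ring.
Qed.

Lemma open_ray O p v : open O -> O p ->
  exists2 e : R, 0 < e & forall t, `|t| <= e -> O (p + t *: v).
Proof.
move=> /openP oO /oO[e e0 He].
have k0 : 0 < `|v.1| + `|v.2| + 1 by rewrite ltr_wpDl// addr_ge0.
exists (e / 2 / (`|v.1| + `|v.2| + 1)); first by rewrite !divr_gt0.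
move=> t; rewrite ler_pdivlMr// => te.
have e2 : e / 2 < e by lra.
apply: He; rewrite !plane_coordE addrAC subrr add0r normrM.
  apply: le_lt_trans e2; apply: le_trans te; rewrite ler_wpM2l//.
  by rewrite -addrA lerDl addr_ge0.
apply: le_lt_trans e2; apply: le_trans te; rewrite ler_wpM2l//.
by rewrite addrAC lerDr addr_ge0.
Qed.

(** The homothety of centre [p] and ratio [t] maps a neighbourhood of [q] into
    [A]. *)
Lemma convex_interior A p q t : convex A -> A p -> A° q -> 0 < t -> t <= 1 ->
  A° (p + t *: (q - p)).
Proof.
move=> /convexP cA Ap Aq t0 t1.
have /openP/(_ _ Aq)[e e0 He] := open_interior A.
have : forall z : plane R, `|z.1 - (p + t *: (q - p)).1| < t * e ->
    `|z.2 - (p + t *: (q - p)).2| < t * e -> A z.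
  move=> z; rewrite !plane_coordE => z1 z2.
  have tn : t != 0 by rewrite gt_eqF.
  have -> : z = p + t *: ((p + t^-1 *: (z - p)) - p).
    by apply/plane_eqP; rewrite !plane_coordE; split; field.
  apply: cA => //; last exact: ltW.
  apply: interior_subset; apply: He; rewrite !plane_coordE.
    have -> : p.1 + t^-1 * (z.1 - p.1) - q.1
        = t^-1 * (z.1 - (p.1 + t * (q.1 - p.1))) by field.
    by rewrite normrM gtr0_norm ?invr_gt0// -ltr_pdivlMl ?invr_gt0// invrK.
  have -> : p.2 + t^-1 * (z.2 - p.2) - q.2
      = t^-1 * (z.2 - (p.2 + t * (q.2 - p.2))) by field.
  by rewrite normrM gtr0_norm ?invr_gt0// -ltr_pdivlMl ?invr_gt0// invrK.
move=> H; rewrite /interior; apply/nbhs_ballP.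
exists (t * e); first by rewrite /= mulr_gt0.
move=> z [/= z1 z2]; apply: H.
  by rewrite distrC.
by rewrite distrC.
Qed.

Lemma interior_convex A : convex A -> convex A°.
Proof.
move=> cA; apply/convexP => p q t Ap Aq t0 t1.
have [->|tn] := eqVneq t 0; first by rewrite scale0r addr0.
apply: convex_interior => //; first exact: interior_subset.
by rewrite lt_def tn.
Qed.

(** Boundedness with an explicit bound on both coordinates, which is the form in
    which it is used for areas and for the exit times of rays. *)
Definition bnd A : Prop := exists M : R, forall p, A p -> `|p.1| <= M /\ `|p.2| <= M.

Lemma bndS A B : A `<=` B -> bnd B -> bnd A.
Proof. by move=> AB [M BM]; exists M => p /AB/BM. Qed.

Lemma bndU A B : bnd A -> bnd B -> bnd (A `|` B).
Proof.
move=> [M AM] [N BN]; exists (Num.max M N) => p [/AM|/BN] [h1 h2].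
  by rewrite !le_max h1 h2.
by rewrite !le_max h1 h2 !orbT.
Qed.

Lemma bnd0 : bnd set0.
Proof. by exists 0. Qed.

Lemma bounded_bnd A : bounded_set A -> bnd A.
Proof.
move=> [M [_ HM]]; exists (M + 1) => p Ap.
have : `|p| <= M + 1 by apply: HM => //; rewrite ltrDl.
by rewrite prod_normE ge_max => /andP[].
Qed.

Definition cbox (M : R) : set (plane R) := [set` `[- M, M]] `*` [set` `[- M, M]].

Lemma cboxP M p : cbox M p <-> `|p.1| <= M /\ `|p.2| <= M.
Proof.
by rewrite !ler_norml; split=> [[/=]|[h1 h2]]; [rewrite !in_itv|split; rewrite /= in_itv].
Qed.

Lemma compact_cbox M : compact (cbox M).
Proof. by apply: compact_setX; exact: segment_compact. Qed.

Lemma closed_bnd_compact A : closed A -> bnd A -> compact A.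
Proof.
move=> cA [M AM]; apply: subclosed_compact (@compact_cbox M) _ => //.
by move=> p /AM/cboxP.
Qed.

Lemma closure_bnd A : bnd A -> bnd (closure A).
Proof.
move=> [M AM]; have clQ : closed (cbox M).
  by apply: compact_closed => //; exact: compact_cbox.
exists M => p clp; apply/cboxP; rewrite ((closure_id (cbox M)).1 clQ).
by move: clp; apply: closureS => q /AM/cboxP.
Qed.

Lemma convexI A B : convex A -> convex B -> convex (A `&` B).
Proof.
move=> /convexP cA /convexP cB; apply/convexP => p q t [Ap Bp] [Aq Bq] t0 t1.
by split; [exact: cA|exact: cB].
Qed.

Lemma open_halfplane u (c : R) : open [set p | dot u p < c].
Proof.
apply/openP => p /= pc.
have k0 : 0 < `|u.1| + `|u.2| + 1 by rewrite ltr_wpDl// addr_ge0.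
exists ((c - dot u p) / (`|u.1| + `|u.2| + 1)).
  by rewrite divr_gt0// subr_gt0.
move=> q; rewrite !ltr_pdivlMr// /mkset /dot => q1 q2.
have n1 : u.1 * (q.1 - p.1) <= `|u.1| * `|q.1 - p.1|.
  by rewrite -normrM ler_norm.
have n2 : u.2 * (q.2 - p.2) <= `|u.2| * `|q.2 - p.2|.
  by rewrite -normrM ler_norm.
move: n1 n2 q1 q2 (normr_ge0 u.1) (normr_ge0 u.2); rewrite /dot in pc *.
move: (normr_ge0 (q.1 - p.1)) (normr_ge0 (q.2 - p.2)).
set x1 := `|_ - _|; set x2 := `|_ - _|; set a := `|u.1|; set b := `|u.2|.
move=> x10 x20 n1 n2 q1 q2 a0 b0.
have [x12|x21] := leP x1 x2.
  have : a * x1 <= a * x2 by rewrite ler_wpM2l.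
  by lra.
have : b * x2 <= b * x1 by rewrite ler_wpM2l// ltW.
by lra.
Qed.

Lemma convex_halfplane u (c : R) : convex [set p | dot u p < c].
Proof.
apply/convexP => p q t /= pc qc t0 t1; rewrite !dotE.
have [h|h] := leP (dot u p) (dot u q); nra.
Qed.

Lemma convex_chalfplane u (c : R) : convex [set p | dot u p <= c].
Proof.
apply/convexP => p q t /= pc qc t0 t1; rewrite !dotE.
by nra.
Qed.

Lemma closed_halfplane u (c : R) : closed [set p | dot u p <= c].
Proof.
rewrite -openC; have := @open_halfplane (- u) (- c); congr open.
by apply/seteqP; split => p /=; rewrite dotNl ltrN2 ltNge => /negP.
Qed.
End Basics.

(** * Separation of disjoint open convex sets *)

Section Separation.
Context {R : realType}.
Implicit Types (A B C : set (plane R)) (p q u v : plane R).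

(** Replace [C] by the open convex cone [K] that it spans; [K] misses the origin.
    On the line through [perp c0] in the direction of some [c0] in [C], the points
    of [K] lie beyond those of [- K], since two points in the wrong order would
    add up to a point of [K] on the ray opposite to [c0].  A point of the line
    that separates the two sets spans a line that avoids [K] altogether. *)
Lemma open_convex_positive C : open C -> convex C -> C !=set0 -> ~ C 0 ->
  exists2 u, u != 0 & forall p, C p -> 0 < dot u p.
Proof.
move=> oC /convexP cC [c0 Cc0] C0.
pose K := [set p | exists2 t : R, 0 < t & C (t *: p)].
have CK p : C p -> K p by move=> Cp; exists 1 => //; rewrite scale1r.
have K0 : ~ K 0 by move=> [t _]; rewrite scaler0.
have Ks (s : R) p : 0 < s -> K p -> K (s *: p).
  move=> s0 [t t0 tp]; exists (t / s); first by rewrite divr_gt0.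
  by rewrite scalerA divfK// gt_eqF.
have KD p q : K p -> K q -> K (p + q).
  move=> [t t0 tp] [s s0 sq]; have ts : 0 < t + s by rewrite addr_gt0.
  exists (t * s / (t + s)); first by rewrite divr_gt0 ?mulr_gt0.
  have := cC _ _ (t / (t + s)) tp sq.
  have h0 : 0 <= t / (t + s) by rewrite divr_ge0// ltW.
  have h1 : t / (t + s) <= 1 by rewrite ler_pdivrMr// mul1r lerDl ltW.
  move=> /(_ h0 h1); congr C; have ts' : t + s != 0 by rewrite gt_eqF.
  by apply/plane_eqP; rewrite !plane_coordE; split; field.
have Kray p v : K p -> exists2 e : R, 0 < e & forall t, `|t| <= e -> K (p + t *: v).
  move=> [t t0 tp]; have [e e0 He] := open_ray (t *: v) oC tp.
  exists e => // s se; exists t => //.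
  by rewrite scalerDr scalerA mulrC -scalerA; exact: He.
have c00 : c0 != 0 by apply/eqP => c00; move: Cc0; rewrite c00.
have Kc0 := CK _ Cc0.
pose w := perp c0.
(* the parameters of the points of - K on the line *)
pose T' := [set t : R | K (- w - t *: c0)].
have T'T t t' : K (w + t *: c0) -> T' t' -> t' < t.
  move=> Kt Kt'; rewrite ltNge; apply/negP => tt'.
  have := KD _ _ Kt Kt'.
  have -> : w + t *: c0 + (- w - t' *: c0) = (t - t') *: c0.
    by apply/plane_eqP; rewrite !plane_coordE; split; ring.
  move: tt'; rewrite le_eqVlt => /predU1P[->|tt'].
    by rewrite subrr scale0r; exact: K0.
  move=> Ktt; apply: K0.
  have := KD _ _ Ktt (Ks (t' - t) _ _ Kc0); rewrite subr_gt0 => /(_ tt').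
  by rewrite -scalerDl addrA subrK subrr scale0r.
have [e e0 He] := Kray _ w Kc0.
have T'ne : T' (- e^-1).
  rewrite /T' /=.
  have -> : - w - (- e^-1) *: c0 = e^-1 *: (c0 + (- e) *: w).
    by apply/plane_eqP; rewrite !plane_coordE; split; field; rewrite gt_eqF.
  by apply: Ks; [rewrite invr_gt0|apply: He; rewrite normrN gtr0_norm].
have Tne : K (w + e^-1 *: c0).
  have -> : w + e^-1 *: c0 = e^-1 *: (c0 + e *: w).
    by apply/plane_eqP; rewrite !plane_coordE; split; field; rewrite gt_eqF.
  by apply: Ks; [rewrite invr_gt0|apply: He; rewrite gtr0_norm].
have T'sup : has_sup T'.
  by split; [exists (- e^-1)|exists e^-1 => t' /(T'T _ _ Tne)/ltW].
pose z := w + sup T' *: c0.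
have nKz : ~ K z.
  move=> /(Kray _ c0)[d d0 /(_ (- d))]; rewrite normrN gtr0_norm// lexx => /(_ isT).
  rewrite /z -addrA -scalerDl => Kd.
  have : sup T' <= sup T' - d.
    by apply: ge_sup => //; [exists (- e^-1)|move=> t' /(T'T _ _ Kd)/ltW].
  by rewrite lerDl oppr_ge0 leNgt d0.
have nKNz : ~ K (- z).
  move=> /(Kray _ c0)[d d0 /(_ (- d))]; rewrite normrN gtr0_norm// lexx => /(_ isT).
  rewrite /z opprD -addrA -scaleNr -scalerDl -opprD scaleNr => Kd.
  have : sup T' + d <= sup T' by apply: ub_le_sup => //; case: T'sup.
  by rewrite gerDl leNgt d0.
pose u := - perp z.
have uc0 : 0 < dot u c0.
  have -> : dot u c0 = dot c0 c0.
    by rewrite /u /z /w /dot !(plane_coordE, perpE); ring.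
  exact: dot_gt0.
have u0 : u != 0 by apply/eqP => u0; move: uc0; rewrite u0 /dot /= !mul0r addr0 ltxx.
exists u => // p /CK Kp; rewrite ltNge; apply/negP => up.
pose b := - (dot u p / dot u c0).
have b0 : 0 <= b by rewrite oppr_ge0 pmulr_lle0// invr_gt0.
have Kpb : K (p + b *: c0).
  move: b0; rewrite le_eqVlt => /predU1P[<-|b0]; first by rewrite scale0r addr0.
  by apply: KD => //; exact: Ks.
have : dot u (p + b *: c0) = 0.
  by rewrite dotDr dotZr /b mulNr divfK ?subrr// gt_eqF.
move=> /(dot0_perp u0)[t].
have -> : perp u = z by apply/plane_eqP; rewrite /u !(perpE, plane_coordE) !opprK.
move=> pz; move: Kpb; rewrite pz.
have [t0|t0|->] := ltgtP t 0; last by rewrite scale0r; exact: K0.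
  move=> /(Ks (- t)^-1); rewrite invr_gt0 oppr_gt0 t0 => /(_ isT).
  by rewrite scalerA invrN mulNr mulVf ?lt_eqF// scaleN1r.
move=> /(Ks t^-1); rewrite invr_gt0 t0 => /(_ isT).
by rewrite scalerA mulVf ?gt_eqF// scale1r.
Qed.

Lemma open_lt_bound A u (c : R) : open A -> u != 0 ->
  (forall p, A p -> dot u p <= c) -> forall p, A p -> dot u p < c.
Proof.
move=> oA u0 uc p Ap; have [e e0 He] := open_ray u oA Ap.
have := uc _ (He e _); rewrite gtr0_norm// lexx => /(_ isT).
by apply: lt_le_trans; rewrite !dotE ltrDl mulr_gt0// dot_gt0.
Qed.

(** The set of differences of points of [B] and of [A] is convex and misses the
    origin. *)
Lemma open_convex_separation A B : open A -> open B -> convex A -> convex B ->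
  A !=set0 -> B !=set0 -> A `&` B = set0 ->
  exists u, exists c : R, [/\ u != 0, forall p, A p -> dot u p < c &
    forall p, B p -> c < dot u p].
Proof.
move=> oA oB /convexP cA /convexP cB [a0 Aa0] [b0 Bb0] AB.
pose C := [set p | exists2 a, A a & B (p + a)].
have oC : open C.
  apply/openP => p [a Aa Bp]; have /openP/(_ _ Bp)[e e0 He] := oB.
  exists e => // q; rewrite -[X in X < e -> _]addr0 => q1 q2; exists a => //.
  by apply: He; rewrite !plane_coordE opprD addrACA subrr addr0 ?addr0 in q1 *.
have cC : convex C.
  apply/convexP => p q t [a Aa Bp] [b Ab Bq] t0 t1.
  exists (a + t *: (b - a)); first exact: cA.
  have -> : p + t *: (q - p) + (a + t *: (b - a)) = (p + a) + t *: ((q + b) - (p + a)).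
    by apply/plane_eqP; rewrite !plane_coordE; split; ring.
  exact: cB.
have C0 : ~ C 0.
  by move=> [a Aa]; rewrite add0r => Ba; have : (A `&` B) a by []; rewrite AB.
have [|u u0 uC] := open_convex_positive oC cC _ C0.
  by exists (b0 - a0); exists a0 => //; rewrite subrK.
have uab a b : A a -> B b -> dot u a < dot u b.
  move=> Aa Bb; have /uC : C (b - a) by exists a => //; rewrite subrK.
  by rewrite !dotE subr_gt0.
pose S := [set dot u a | a in A].
have Ssup : has_sup S.
  by split; [exists (dot u a0), a0|exists (dot u b0) => _ [a Aa <-]; exact/ltW/uab].
exists u, (sup S); split => //.
  apply: open_lt_bound => // p Ap; apply: ub_le_sup; first by case: Ssup.
  by exists p.
have := @open_lt_bound B (- u) (- sup S) oB.
rewrite oppr_eq0 => /(_ u0) H p Bp; have := H _ p Bp.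
rewrite dotNl ltrN2; apply => q Bq; rewrite dotNl lerN2.
by apply: ge_sup; [case: Ssup|move=> _ [a Aa <-]; exact/ltW/uab].
Qed.

End Separation.

(** * Maximal families of disjoint open convex sets *)

Section MaximalFamily.
Context {R : realType} (I : finType).

Definition convex_packing (O : I -> set (plane R)) : Prop :=
  [/\ forall i, open (O i), forall i, convex (O i) &
      forall i j, i != j -> O i `&` O j = set0].

(** Open convex sets, rather than compact ones, make the union of a chain of
    families another such family, so that Zorn's lemma applies directly.  A family
    is encoded by a subset of [I * plane R], so that its enlargement is plain
    inclusion; the sets [B i] are added to the sections afterwards, which makes the
    empty chain harmless. *)
Lemma maximal_packing (B : I -> set (plane R)) : convex_packing B ->
  exists O, [/\ convex_packing O, forall i, B i `<=` O i &
    forall i X, open X -> convex X -> O i `<=` X ->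
      (forall j, j != i -> X `&` O j = set0) -> X `<=` O i].
Proof.
move=> [oB cB dB].
pose sec (A : set (I * plane R)) i := [set p | A (i, p) \/ B i p].
have [|A [PA maxA]] := @Zorn_bigcup _ (fun A => convex_packing (sec A)).
  move=> F FP Ftot.
  have pairF i j p q : sec (\bigcup_(X in F) X) i p ->
      sec (\bigcup_(X in F) X) j q ->
      (exists X, [/\ F X, sec X i p & sec X j q]) \/ (B i p /\ B j q).
    move=> [[X FX Xp]|Bp] [[Y FY Yq]|Bq].
    - left; have [XY|YX] := Ftot _ _ FX FY.
        by exists Y; split => //; left => //; exact: XY.
      by exists X; split => //; left => //; exact: YX.
    - by left; exists X; split => //; [left|right].
    - by left; exists Y; split => //; [right|left].
    - by right.
  have secF X i : F X -> sec X i `<=` sec (\bigcup_(X in F) X) i.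
    by move=> FX p [Xp|Bp]; [left; exists X|right].
  have secB i : B i `<=` sec (\bigcup_(X in F) X) i by move=> p; right.
  split.
  - move=> i; apply/openP => p /[dup] Ap /(pairF i i p p Ap)[[X [FX Xp _]]|[Bp _]].
      have [/(_ i)/openP/(_ _ Xp)[e e0 He] _ _] := FP _ FX.
      by exists e => // q q1 q2; apply: (secF X) => //; exact: He.
    have /openP/(_ _ Bp)[e e0 He] := oB i.
    by exists e => // q q1 q2; apply: secB; exact: He.
  - move=> i; apply/convexP => p q t Ap Aq t0 t1.
    have [[X [FX Xp Xq]]|[Bp Bq]] := pairF _ _ _ _ Ap Aq.
      have [_ /(_ i)/convexP cX _] := FP _ FX.
      by apply: (secF X) => //; exact: cX.
    by apply: secB; have /convexP := cB i; exact.
  - move=> i j ij; rewrite -subset0 => p [Ap Aq].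
    have [[X [FX Xp Xq]]|[Bp Bq]] := pairF _ _ _ _ Ap Aq.
      have [_ _ /(_ i j ij) XX] := FP _ FX.
      by rewrite -XX.
    by rewrite -(dB i j ij).
exists (sec A); split => //; first by move=> i p; right.
move=> i X oX cX AX dX p Xp; apply: contrapT => nAp.
have [oA cA dA] := PA.
apply: (maxA (A `|` [set ip | ip.1 = i /\ X ip.2])).
  rewrite properEneq; split; last by move=> ?; left.
  apply/eqP => AE; apply: nAp; left; rewrite AE; by right.
have secE : sec (A `|` [set ip | ip.1 = i /\ X ip.2]) =
    fun j => if j == i then X else sec A j.
  apply/funext => j; apply/seteqP; split => [q|q].
    rewrite /sec /=; have [->|ji] := eqVneq j i.
      by move=> [[Aq|[_ Xq]]|Bq] => //; apply: AX; [left|right].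
    by move=> [[Aq|[ji']]|Bq]; [left|rewrite ji' eqxx in ji|right].
  have [->|ji] := eqVneq j i; first by move=> Xq; left; right.
  by move=> [Aq|Bq]; [left; left|right].
rewrite secE; split => [j|j|j k jk].
- by case: ifP.
- by case: ifP.
- have [ji|ji] := eqVneq j i; have [ki|ki] := eqVneq k i.
  + by rewrite ji ki eqxx in jk.
  + exact: dX.
  + by rewrite setIC; exact: dX.
  + exact: dA.
Qed.

End MaximalFamily.

(** * Counting neighbours along a sweep *)

Section Consecutive.
Context {R : realType} (I : finType) (above : rel I).

(** [A] is the set of the intervals that meet a given vertical line; [j] is then
    the interval directly above [i] on this line. *)
Definition consecutive (A : pred I) (i j : I) : bool :=
  [&& A i, A j, above i j & [forall l, A l ==> ~~ (above i l && above l j)]].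

Lemma consecutiveP (A : pred I) i j : reflect
  [/\ A i, A j, above i j & forall l, A l -> above i l -> above l j -> False]
  (consecutive A i j).
Proof.
apply: (iffP and4P) => -[Ai Aj ij H]; split => //.
  by move=> l Al il lj; move: H => /forallP/(_ l); rewrite Al il lj.
by apply/forallP => l; apply/implyP => Al; apply/negP => /andP[]; exact: H.
Qed.

Section Level.
Variables (A : pred I) (y : I -> R).
Hypothesis aboveE : forall i j, A i -> A j -> above i j = (y i < y j).
Hypothesis y_neq : forall i j, A i -> A j -> i != j -> y i != y j.

Lemma consecutive_inj_above i j k :
  consecutive A i j -> consecutive A i k -> j = k.
Proof.
move=> /consecutiveP[Ai Aj ij Hj] /consecutiveP[_ Ak ik Hk].
apply/eqP/negPn/negP => jk; have := y_neq Aj Ak jk.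
rewrite neq_lt -!aboveE// => /orP[h|h]; [exact: Hk h|exact: Hj h].
Qed.

Lemma consecutive_inj_below i j k :
  consecutive A j i -> consecutive A k i -> j = k.
Proof.
move=> /consecutiveP[Aj Ai ij Hj] /consecutiveP[Ak _ ik Hk].
apply/eqP/negPn/negP => jk; have := y_neq Aj Ak jk.
rewrite neq_lt -!aboveE// => /orP[h|h]; [exact: Hj h _|exact: Hk h _].
Qed.

Lemma exists_consecutive i l : A i -> A l -> above i l ->
  exists2 j, consecutive A i j & j = l \/ above j l.
Proof.
move=> Ai Al il.
pose P := [pred j | A j && above i j].
have Pl : P l by rewrite /= Al il.
case: (arg_minP y Pl) => j /andP[Aj ij] jmin.
exists j.
  apply/consecutiveP; split => // k Ak ik; rewrite aboveE// ltNge jmin//.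
  by rewrite /= Ak ik.
have [->|jl] := eqVneq j l; [by left|right].
by rewrite aboveE// lt_neqAle y_neq//= jmin.
Qed.

Lemma exists_consecutive_below i l : A i -> A l -> above l i ->
  exists2 j, consecutive A j i & j = l \/ above l j.
Proof.
move=> Ai Al li.
pose P := [pred j | A j && above j i].
have Pl : P l by rewrite /= Al li.
case: (arg_maxP y Pl) => j /andP[Aj ji] jmax.
exists j.
  apply/consecutiveP; split => // k Ak jk ki; move: jk; rewrite aboveE// ltNge => /negP; apply.
  by apply: jmax; rewrite /= Ak ki.
have [->|jl] := eqVneq j l; [by left|right].
by rewrite aboveE// lt_neqAle eq_sym y_neq//=; exact: jmax.
Qed.

End Level.

(** The line sweeps over finitely many slots [t]. *)
Section Slots.
Variables (T : nat) (act : nat -> pred I) (y : nat -> I -> R).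
Hypothesis act_itv : forall i t1 t2 t3, (t1 <= t2 <= t3)%N -> (t3 < T)%N ->
  act t1 i -> act t3 i -> act t2 i.
Hypothesis aboveE : forall t i j, act t i -> act t j ->
  above i j = (y t i < y t j).
Hypothesis y_neq : forall t i j, act t i -> act t j -> i != j -> y t i != y t j.

Let starts t i := [&& (t < T)%N, act t i & (t == 0)%N || ~~ act t.-1 i].
Let ends t i := [&& (t.+1 < T)%N, act t i & ~~ act t.+1 i].

Let starts_uniq t t' i : starts t i -> starts t' i -> t = t'.
Proof.
wlog tt' : t t' / (t <= t')%N.
  by move=> h; case: (leqP t t') => [|/ltnW] tt' a b; [|symmetry]; exact: h.
move=> /and3P[tT at1 at2] /and3P[tT' at1' at2'].
apply/eqP; rewrite eqn_leq tt' /= leqNgt; apply/negP => ltt.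
case/orP: at2' => [/eqP t0|]; first by rewrite t0 in ltt.
by move=> /negP; apply; apply: (@act_itv i t _ t') => //; lia.
Qed.

Let ends_uniq t t' i : ends t i -> ends t' i -> t = t'.
Proof.
wlog tt' : t t' / (t <= t')%N.
  by move=> h; case: (leqP t t') => [|/ltnW] tt' a b; [|symmetry]; exact: h.
move=> /and3P[tT at1 at2] /and3P[tT' at1' at2'].
apply/eqP; rewrite eqn_leq tt' /= leqNgt; apply/negP => ltt.
by move: at2 => /negP; apply; apply: (@act_itv i t _ t') => //; lia.
Qed.

(** A consecutive pair is charged to the event that creates it: the start of its
    lower member, the start of its upper member, or the end of the interval that
    was directly above its lower member one slot earlier. *)
Let spec (tok : I + I + I) (p : I * I) : Prop :=
  match tok with
  | inl (inl i) => i = p.1 /\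
      exists2 t, starts t i & consecutive (act t) p.1 p.2
  | inl (inr j) => j = p.2 /\
      exists2 t, starts t j & consecutive (act t) p.1 p.2
  | inr l => exists t, [/\ ends t l, consecutive (act t) p.1 l &
                        consecutive (act t.+1) p.1 p.2]
  end.

(** Each index starts and ends in one slot only, and the neighbours above and
    below are unique in a slot, so that the event determines the pair. *)
Let spec_inj tok p q : spec tok p -> spec tok q -> p = q.
Proof.
case: p q => [i j] [i' j']; case: tok => [[k|k]|k] /=.
- move=> [-> [t st ct]] [ii' [t' st' ct']]; rewrite -ii' in ct' *.
  rewrite (starts_uniq st' st) in ct'.
  by rewrite (consecutive_inj_above (@aboveE t) (@y_neq t) ct ct').
- move=> [-> [t st ct]] [ii' [t' st' ct']]; rewrite -ii' in ct' *.
  rewrite (starts_uniq st' st) in ct'.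
  by rewrite (consecutive_inj_below (@aboveE t) (@y_neq t) ct ct').
- move=> [t [st ct dt]] [t' [st' ct' dt']].
  rewrite (ends_uniq st' st) in ct' dt'.
  rewrite -(consecutive_inj_below (@aboveE t) (@y_neq t) ct ct') in dt' *.
  by rewrite (consecutive_inj_above (@aboveE t.+1) (@y_neq t.+1) dt dt').
Qed.

(** In the first slot where the pair is consecutive, if neither member has just
    started, then some interval separated them in the previous slot; as the relation
    [above] does not depend on the slot, it must have ended. *)
Let spec_exists p : (exists2 t, (t < T)%N & consecutive (act t) p.1 p.2) ->
  exists tok, spec tok p.
Proof.
case: p => [i j] /= [t0 t0T ct0].
have exc : exists t, consecutive (act t) i j by exists t0.
case: (ex_minnP exc) => t ct tmin.
have tT : (t < T)%N by apply: leq_ltn_trans t0T; exact: tmin.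
have /consecutiveP[ai aj ij nbetween] := ct.
have [si|] := boolP (starts t i); first by exists (inl (inl i)); split => //; exists t.
rewrite /starts tT ai /= negb_or negbK => /andP[t_gt0 ai'].
have [sj|] := boolP (starts t j); first by exists (inl (inr j)); split => //; exists t.
rewrite /starts tT aj /= negb_or negbK => /andP[_ aj'].
have [k ck [kj|kj]] := exists_consecutive (@aboveE t.-1) (@y_neq t.-1) ai' aj' ij.
  by have := tmin t.-1; rewrite -{1}kj => /(_ ck); lia.
have tE : t.-1.+1 = t by rewrite prednK// lt0n.
exists (inr k), t.-1; rewrite tE; split => //.
have /consecutiveP[_ ak ik _] := ck.
rewrite /ends tE tT ak /=; apply/negP => ak'.
exact: nbetween ak' ik kj.
Qed.

Lemma slots_consecutive_le (V : {set I * I}) :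
  (forall p, p \in V ->
     exists2 t, (t < T)%N & consecutive (act t) p.1 p.2) ->
  (#|V| <= 3 * #|I|)%N.
Proof.
move=> VP; have [->|[[i0 j0] p0V]] := set_0Vmem V; first by rewrite cards0.
have tokP p : exists tok : I + I + I, p \in V -> spec tok p.
  have [/VP/spec_exists[k kp]|_] := boolP (p \in V); last by exists (inr i0).
  by exists k.
have [f fP] := choice tokP.
rewrite -(card_in_imset (f := f)); last first.
  move=> p q pV qV fpq; have := fP _ qV; rewrite -fpq; apply: spec_inj.
  exact: fP.
by apply: leq_trans (max_card _) _; rewrite !card_sum; lia.
Qed.

End Slots.

Section Line.
Variables (act : R -> pred I) (y : R -> I -> R).
Hypothesis act_itv : forall i x1 x2 x3, x1 <= x2 -> x2 <= x3 ->
  act x1 i -> act x3 i -> act x2 i.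
Hypothesis aboveE : forall x i j, act x i -> act x j ->
  above i j = (y x i < y x j).
Hypothesis y_neq : forall x i j, act x i -> act x j -> i != j -> y x i != y x j.

(** Consecutiveness at [x] depends only on the set of indices active at [x], and
    there are finitely many such sets: one sample point for each of them, in
    increasing order, provides the slots. *)
Lemma line_consecutive_le (V : {set I * I}) :
  (forall p, p \in V -> exists x, consecutive (act x) p.1 p.2) ->
  (#|V| <= 3 * #|I|)%N.
Proof.
move=> VP.
pose pat x := [set i | act x i]%SET.
have sampleP (A : {set I}) : exists x, (exists x', pat x' = A) -> pat x = A.
  by have [[x xA]|nA] := pselect (exists x', pat x' = A); [exists x|exists 0].
have [f fP] := choice sampleP.
pose s := sort <=%O [seq f A | A : {set I}].
have s_sorted : sorted <=%O s by apply: sort_sorted; exact: le_total.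
have sP x : exists2 t, (t < size s)%N & act (nth 0 s t) = act x.
  have fs : f (pat x) \in s by rewrite mem_sort map_f// mem_enum.
  exists (index (f (pat x)) s); first by rewrite index_mem.
  rewrite nth_index//; apply/funext => i.
  have : i \in pat (f (pat x)) = (i \in pat x) by rewrite fP//; exists x.
  by rewrite !inE.
apply: (@slots_consecutive_le (size s) (fun t => act (nth 0 s t))
   (fun t => y (nth 0 s t))).
- move=> i t1 t2 t3 /andP[t12 t23] t3s.
  have t2s : (t2 < size s)%N by exact: leq_ltn_trans t3s.
  have t1s : (t1 < size s)%N by exact: leq_ltn_trans t2s.
  have s_homo := sorted_leq_nth (@le_trans _ R) (@le_refl _ R) 0 s_sorted.
  by apply: act_itv; apply: s_homo.
- by move=> t i j; exact: aboveE.
- by move=> t i j; exact: y_neq.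
- move=> p /VP[x xp]; have [t ts tE] := sP x.
  by exists t => //; rewrite tE.
Qed.

End Line.
End Consecutive.

(** * Convex polygons given by finitely many constraints *)

Section FiniteChoice.
Context {R : realType}.

Lemma avoid_seq (s : seq R) (e : R) : 0 < e ->
  exists t, [/\ 0 < t, t <= e & t \notin s].
Proof.
move=> e0; elim: s e e0 => [|x s IH] e e0; first by exists e.
have [x0|x0] := leP x 0.
  have [t [t0 te ts]] := IH _ e0; exists t; split => //.
  by rewrite inE negb_or ts andbT gt_eqF// (le_lt_trans x0).
have [|t [t0 te ts]] := IH (Num.min e (x / 2)).
  by rewrite lt_min e0 divr_gt0.
move: te; rewrite le_min => /andP[te tx]; exists t; split => //.
by rewrite inE negb_or ts andbT lt_eqF// (le_lt_trans tx)//; lra.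
Qed.

Lemma uniform_radius (J : finType) (Q : J -> R -> Prop) :
  (forall b, exists2 e : R, 0 < e & forall t, `|t| <= e -> Q b t) ->
  exists2 e : R, 0 < e & forall b t, `|t| <= e -> Q b t.
Proof.
move=> H; have /choice[f fP] : forall b, exists e : R, 0 < e /\
    forall t, `|t| <= e -> Q b t.
  by move=> b; have [e e0 He] := H b; exists e.
exists (\big[Num.min/1]_b f b).
  by elim/big_ind: _ => // [x y x0 y0|b _]; [rewrite lt_min x0|case: (fP b)].
move=> b t tb; apply: (fP b).2; apply: le_trans tb _.
by rewrite (bigminD1 b)// ge_min lexx.
Qed.

End FiniteChoice.

Section Polyhedron.
Context {R : realType}.
Implicit Types (L : set (plane R * R)) (p q u v w : plane R).

Definition open_polyhedron L : set (plane R) := [set p | forall l, L l -> dot l.1 p < l.2].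
Definition closed_polyhedron L : set (plane R) := [set p | forall l, L l -> dot l.1 p <= l.2].

Lemma open_polyhedron_sub L : open_polyhedron L `<=` closed_polyhedron L.
Proof. by move=> p Op l Ll; exact/ltW/Op. Qed.

Lemma convex_closed_polyhedron L : convex (closed_polyhedron L).
Proof.
apply/convexP => p q t Pp Pq t0 t1 l Ll.
by have /convexP := @convex_chalfplane R l.1 l.2; apply => //; [exact: Pp|exact: Pq].
Qed.

Lemma convex_open_polyhedron L : convex (open_polyhedron L).
Proof.
apply/convexP => p q t Pp Pq t0 t1 l Ll.
by have /convexP := @convex_halfplane R l.1 l.2; apply => //; [exact: Pp|exact: Pq].
Qed.

Lemma segment_open_polyhedron L p q0 t : closed_polyhedron L p ->
  open_polyhedron L q0 -> 0 < t -> t <= 1 ->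
  open_polyhedron L (p + t *: (q0 - p)).
Proof.
move=> Pp Oq0 t0 t1 l Ll; have := Pp l Ll; have := Oq0 l Ll; rewrite !dotE => h1 h2.
by nra.
Qed.

(** The open polyhedron determines the closed one, so that two lists of
    constraints with the same open solutions can be exchanged. *)
Lemma closed_polyhedronE L : open_polyhedron L !=set0 -> closed_polyhedron L = [set p | forall q0 t,
  open_polyhedron L q0 -> 0 < t -> t <= 1 -> open_polyhedron L (p + t *: (q0 - p))].
Proof.
move=> [q0 Oq0]; apply/seteqP; split => [p Pp q t|p H l Ll].
  exact: segment_open_polyhedron.
rewrite leNgt; apply/negP => lp.
have ol := Oq0 l Ll.
have d0 : 0 < dot l.1 p - dot l.1 q0 by rewrite subr_gt0 (lt_trans ol).
pose t := (dot l.1 p - l.2) / (dot l.1 p - dot l.1 q0).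
have t0 : 0 < t by rewrite divr_gt0// subr_gt0.
have t1 : t <= 1 by rewrite ler_pdivrMr// mul1r lerD2l lerN2 ltW.
have := H q0 t Oq0 t0 t1 l Ll; rewrite !dotE.
have -> : t * (dot l.1 q0 - dot l.1 p) = - (dot l.1 p - l.2).
  by rewrite -[in LHS]opprB mulrN /t divfK// gt_eqF.
by rewrite opprB addrC subrK ltxx.
Qed.

Lemma closed_polyhedron_eq L L' : open_polyhedron L !=set0 ->
  open_polyhedron L = open_polyhedron L' -> closed_polyhedron L = closed_polyhedron L'.
Proof. by move=> L0 LL'; rewrite !closed_polyhedronE -?LL'. Qed.

Lemma parallel_normal u v x y : u != 0 -> v != 0 -> x != y ->
  dot u x = dot u y -> dot v x = dot v y -> exists2 k : R, k != 0 & v = k *: u.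
Proof.
move=> u0 v0 xy uxy vxy.
have d0 : y - x != 0 by rewrite subr_eq0 eq_sym.
have [|a ua] := @dot0_perp R (y - x) u d0.
  by transitivity (dot u y - dot u x); [rewrite -dotNr -dotDr /dot; ring|rewrite uxy subrr].
have [|b vb] := @dot0_perp R (y - x) v d0.
  by transitivity (dot v y - dot v x); [rewrite -dotNr -dotDr /dot; ring|rewrite vxy subrr].
have a0 : a != 0 by apply: contraNneq u0 => a0; rewrite ua a0 scale0r.
have b0 : b != 0 by apply: contraNneq v0 => b0; rewrite vb b0 scale0r.
exists (b / a); first by rewrite mulf_neq0// invr_eq0.
by rewrite vb ua scalerA divfK.
Qed.

(** The midpoint of two points of a side lies on the boundary, so it saturates some
    constraint; both points then saturate it as well, and the line of this
    constraint is the line of the side. *)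
Lemma side_constraint L S : open (open_polyhedron L) -> open_polyhedron L !=set0 ->
  is_side (closed_polyhedron L) S ->
  exists l, [/\ L l, l.1 != 0, S = [set x | closed_polyhedron L x /\ dot l.1 x = l.2]
    & exists x y, [/\ S x, S y & x <> y]].
Proof.
move=> oO [q0 Oq0] [u [c [u0 Pc SE [x [y [Sx Sy /eqP xy]]]]]].
have [Px ux] : closed_polyhedron L x /\ dot u x = c by move: Sx; rewrite SE.
have [Py uy] : closed_polyhedron L y /\ dot u y = c by move: Sy; rewrite SE.
pose z := x + 2^-1 *: (y - x).
have uz : dot u z = c by rewrite !dotE ux uy subrr mulr0 addr0.
have nOz : ~ open_polyhedron L z.
  move=> /(open_lt_bound oO u0 (c := c)); rewrite uz ltxx.
  by move=> H; have /H : forall p, open_polyhedron L p -> dot u p <= c by move=> p /open_polyhedron_sub/Pc.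
have [l Ll lz] : exists2 l, L l & l.2 <= dot l.1 z.
  apply: contrapT => H; apply: nOz => l Ll; rewrite ltNge; apply/negP => lz.
  by apply: H; exists l.
have lx := Px l Ll; have ly := Py l Ll.
have [{}lx {}ly] : dot l.1 x = l.2 /\ dot l.1 y = l.2.
  by move: lz; rewrite !dotE; split; lra.
have l0 : l.1 != 0.
  by apply/eqP => l0; have := Oq0 l Ll; rewrite -lx l0 /dot /= !mul0r addr0 ltxx.
exists l; split => //; last by exists x, y; split => //; exact/eqP.
have [||k k0 lk] := @parallel_normal u l.1 x y u0 l0 xy; [by rewrite ux uy|by rewrite lx ly|].
rewrite SE; apply/seteqP; split => w /= [Pw uw]; split => //.
  by rewrite lk dotZl uw -ux -dotZl -lk.
by apply: (mulfI k0); rewrite -dotZl -lk uw -lx lk dotZl ux.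
Qed.

End Polyhedron.

Section Polygon.
Context {R : realType} (J : finType) (u : J -> plane R) (c : J -> R).
Implicit Types (p q v w z : plane R).

Definition constraints : set (plane R * R) := range (fun a => (u a, c a)).

Let O := open_polyhedron constraints.
Let P := closed_polyhedron constraints.

Let OP p : O p <-> forall a, dot (u a) p < c a.
Proof. by split=> [Op a|H _ [a _ <-]]; [apply: (Op (u a, c a)); exists a|exact: H]. Qed.

Let PP p : P p <-> forall a, dot (u a) p <= c a.
Proof. by split=> [Op a|H _ [a _ <-]]; [apply: (Op (u a, c a)); exists a|exact: H]. Qed.

Lemma open_polygon : open O.
Proof.
apply/openP => p /OP Op.
have [|e e0 He] := @uniform_radius R J (fun a e => forall q,
    `|q.1 - p.1| < `|e| -> `|q.2 - p.2| < `|e| -> dot (u a) q < c a).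
  move=> a; have /openP/(_ p (Op a))[e e0 He] := @open_halfplane R (u a) (c a).
  by exists e => // t te q q1 q2; apply: He; exact: lt_le_trans te.
exists e => // q q1 q2; apply/OP => a; by apply: (He a e); rewrite (gtr0_norm e0).
Qed.

Lemma closed_polygon : closed P.
Proof.
have -> : P = \bigcap_a [set p | dot (u a) p <= c a].
  by apply/seteqP; split => p; [move=> /PP H a _; exact: H|move=> H; apply/PP => a; exact: H].
by apply: closed_bigI => a _; exact: closed_halfplane.
Qed.

Hypothesis O_neq0 : O !=set0.
Hypothesis P_bounded : bnd P.

Lemma exit_point p v : P p -> v != 0 -> exists t a,
  [/\ 0 <= t, P (p + t *: v), 0 < dot (u a) v & dot (u a) (p + t *: v) = c a].
Proof.
move=> /PP Pp v0.
have [a0 ua0] : exists a, 0 < dot (u a) v.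
  apply: contrapT => H; have {}H a : dot (u a) v <= 0.
    by rewrite leNgt; apply/negP => ua; apply: H; exists a.
  have Pt t : 0 <= t -> P (p + t *: v).
    move=> t0; apply/PP => a; rewrite !dotE; have := Pp a; have := H a; nra.
  have [M PM] := P_bounded.
  have vv : 0 < `|v.1| + `|v.2|.
    by rewrite lt_def addr_ge0// andbT paddr_eq0// !normr_eq0 negb_and -plane_neq0.
  have M0 : 0 <= M by have [+ _] := PM _ (Pt 0 (lexx 0)); exact: le_trans.
  have [t tE] : exists t, t = (M + M + `|p.1| + `|p.2| + 1) / (`|v.1| + `|v.2|) by eexists.
  have t0 : 0 <= t by rewrite tE divr_ge0// !addr_ge0.
  have [h1 h2] := PM _ (Pt t t0); rewrite !plane_coordE in h1 h2.
  have k1 : `|t * v.1| <= M + `|p.1|.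
    have -> : t * v.1 = p.1 + t * v.1 - p.1 by ring.
    by apply: le_trans (ler_normB _ _) _; rewrite lerD2r.
  have k2 : `|t * v.2| <= M + `|p.2|.
    have -> : t * v.2 = p.2 + t * v.2 - p.2 by ring.
    by apply: le_trans (ler_normB _ _) _; rewrite lerD2r.
  have : `|t * v.1| + `|t * v.2| = M + M + `|p.1| + `|p.2| + 1.
    by rewrite !normrM (ger0_norm t0) -mulrDr tE divfK// gt_eqF.
  by lra.
pose r a := (c a - dot (u a) p) / dot (u a) v.
have r_ge0 a : 0 < dot (u a) v -> 0 <= r a.
  by move=> ua; rewrite divr_ge0 ?subr_ge0// ltW.
case: (@arg_minP _ _ _ a0 (fun a => 0 < dot (u a) v) r ua0) => a ua amin.
exists (r a), a; split => //; first exact: r_ge0.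
  apply/PP => b; rewrite !dotE.
  have [ub|ub] := ltP 0 (dot (u b) v).
    have := amin b ub; rewrite {2}/r ler_pdivlMr//; lra.
  by have := Pp b; have := r_ge0 a ua; nra.
by rewrite !dotE /r divfK ?gt_eqF//; lra.
Qed.

Definition det2 v w : R := v.1 * w.2 - v.2 * w.1.

Lemma dot_perpr v w : dot v (perp w) = - det2 v w.
Proof. by rewrite /dot /det2 !perpE; ring. Qed.

Definition corner (ab : J * J) : plane R :=
  (det2 (u ab.1) (u ab.2))^-1 *:
  (c ab.1 * (u ab.2).2 - c ab.2 * (u ab.1).2,
   c ab.2 * (u ab.1).1 - c ab.1 * (u ab.2).1).

Lemma cornerE a b p : det2 (u a) (u b) != 0 ->
  dot (u a) p = c a -> dot (u b) p = c b -> p = corner (a, b).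
Proof.
move=> d0 pa pb; apply/plane_eqP; rewrite /corner !plane_coordE /= -pa -pb.
by move: d0; rewrite /det2 /dot => d0; split; field.
Qed.

Definition corners : set (plane R) := P `&` range corner.

Lemma finite_corners : finite_set corners.
Proof.
apply: (@sub_finite_set _ _ (range corner)); first by move=> p [].
by apply: finite_image; exact: finite_finset.
Qed.

(** From a point of [P], moving both ways along any line leads to edges of [P],
    and moving along an edge leads to corners. *)
Lemma polygon_hull : P = conv_hull corners.
Proof.
apply/seteqP; split; last first.
  apply: smallest_sub; first exact: convex_closed_polyhedron.
  by move=> p [].
have mid (C : set (plane R)) p v (s t : R) : convex C -> 0 <= s -> 0 <= t ->
    C (p + s *: v) -> C (p + t *: (- v)) -> C p.
  move=> /convexP cC s0 t0 Cs Ct.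
  have [st|st] := eqVneq (s + t) 0.
    have s00 : s = 0 by lra.
    by move: Cs; rewrite s00 scale0r addr0.
  have st0 : 0 < s + t by rewrite lt_def st addr_ge0.
  have := cC _ _ (s / (s + t)) Cs Ct.
  rewrite divr_ge0// ?addr_ge0// ler_pdivrMr// mul1r lerDl => /(_ isT t0).
  by congr C; apply/plane_eqP; rewrite !plane_coordE; split; field.
have edge p a : P p -> u a != 0 -> dot (u a) p = c a ->
    forall C, convex C -> corners `<=` C -> C p.
  move=> Pp ua pa C cC VC.
  have v0 : perp (u a) != 0.
    by rewrite plane_neq0 !perpE oppr_eq0 orbC -plane_neq0.
  have nv0 : - perp (u a) != 0 by rewrite oppr_eq0.
  have [s [b [s0 Ps ub bs]]] := exit_point Pp v0.
  have [t [d [t0 Pt ud dt]]] := exit_point Pp nv0.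
  apply: (mid C p (perp (u a)) s t) => //; apply: VC; split => //.
    exists (b, a) => //; symmetry; apply: cornerE => //.
      by rewrite -oppr_eq0 -dot_perpr gt_eqF.
    by rewrite !dotE dot_perp mulr0 addr0.
  exists (d, a) => //; symmetry; apply: cornerE => //.
    by move: ud; rewrite dotNr dot_perpr opprK => /gt_eqF ->.
  by rewrite !dotE dot_perp oppr0 mulr0 addr0.
move=> p Pp C [cC VC].
have v0 : ((1, 0) : plane R) != 0 by rewrite plane_neq0 /= oner_neq0.
have nv0 : - ((1, 0) : plane R) != 0 by rewrite oppr_eq0.
have [s [b [s0 Ps ub bs]]] := exit_point Pp v0.
have [t [d [t0 Pt ud dt]]] := exit_point Pp nv0.
have nz v w : 0 < dot v w -> v != 0.
  by apply: contraTneq => ->; rewrite /dot /= !mul0r addr0 ltxx.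
apply: (mid C p (1, 0) s t) => //.
  exact: (edge _ b Ps (nz _ _ ub) bs).
exact: (edge _ d Pt (nz _ _ ud) dt).
Qed.

(** A ray in the direction [v] leaves [P] through the relative interior of a side
    as soon as it avoids the finitely many corners, which is the case for a
    suitable starting point in [O]. *)
Lemma exposed_side v : v != 0 -> exists S u' c',
  [/\ is_side P S, 0 < dot u' v, forall p, P p -> dot u' p <= c'
    & S = [set x | P x /\ dot u' x = c']].
Proof.
move=> v0; have [p0 Op0] := O_neq0.
have w0 : perp v != 0 by rewrite plane_neq0 !perpE oppr_eq0 orbC -plane_neq0.
have ww := dot_gt0 w0.
have [e e0 He] := open_ray (perp v) open_polygon Op0.
have [V VE] := (finite_seqP _).1 finite_corners.
have [t [t0 te tV]] := avoid_seq
  [seq (dot (perp v) w - dot (perp v) p0) / dot (perp v) (perp v) | w <- V] e0.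
pose p := p0 + t *: perp v.
have Op : O p by apply: He; rewrite gtr0_norm.
have [s [a [s0 Pz ua az]]] := exit_point (open_polyhedron_sub Op) v0.
set z := p + s *: v in Pz az.
(* the functional dot (perp v) is constant along the ray and separates z from the
   corners *)
have zV : ~ corners z.
  move=> zV; have : z \in V by move: zV; rewrite VE.
  apply/negP; apply: contra tV => zV'; apply/mapP; exists z => //.
  rewrite /z /p !dotE addrAC.
  have -> : dot (perp v) v = 0 by rewrite /dot !perpE; ring.
  by rewrite mulr0 addr0 addrAC subrr add0r mulfK// gt_eqF.
have ua0 : u a != 0.
  by apply: contraTneq ua => ->; rewrite /dot /= !mul0r addr0 ltxx.
have /PP Pz' := Pz.
have act b : dot (u b) z = c b -> dot (u b) (perp (u a)) = 0.
  move=> bz; rewrite dot_perpr; apply/eqP; rewrite oppr_eq0; apply/negPn/negP => d0.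
  by apply: zV; split => //; exists (b, a) => //; rewrite -(cornerE d0 bz az).
(* only constraints parallel to a are saturated at z, so P contains a segment of
   the line of a around z *)
have [|r r0 Hr] := @uniform_radius R J
    (fun b t => dot (u b) (z + t *: perp (u a)) <= c b).
  move=> b; have [bz|bz] := eqVneq (dot (u b) z) (c b).
    by exists 1 => // r _; rewrite dotDr dotZr act// mulr0 addr0 bz.
  have bz' : dot (u b) z < c b by rewrite lt_neqAle bz Pz'.
  have [r r0 Hr] := open_ray (perp (u a)) (@open_halfplane R (u b) (c b)) bz'.
  by exists r => // x /Hr/ltW.
pose z' := z + r *: perp (u a).
have Pz2 : P z' by apply/PP => b; apply: Hr; rewrite gtr0_norm.
exists [set x | P x /\ dot (u a) x = c a], (u a), (c a); split => //; last first.
  by move=> q /PP.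
exists (u a), (c a); split => //; first by move=> q /PP.
exists z, z'; split => //.
  by split => //; rewrite dotDr dotZr az dot_perp mulr0 addr0.
have w0' : perp (u a) != 0 by rewrite plane_neq0 !perpE oppr_eq0 orbC -plane_neq0.
move=> /eqP; rewrite /z' -subr_eq0 opprD addrA subrr add0r oppr_eq0 scaler_eq0.
by rewrite (gt_eqF r0) (negPf w0').
Qed.

Lemma polygon_body : convex_body P.
Proof.
split; first exact: convex_closed_polyhedron.
  exact: closed_bnd_compact closed_polygon P_bounded.
have [q0 Oq0] := O_neq0; exists q0.
have /interior_subset : O° q0 by have := open_polygon; rewrite openE; exact.
move=> _; apply: (@interiorS _ O P); first exact: open_polyhedron_sub.
by have := open_polygon; rewrite openE; exact.
Qed.

Lemma same_side_normal u1 u2 (c1 c2 : R) S : is_side P S -> u1 != 0 -> u2 != 0 ->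
  (forall p, P p -> dot u1 p <= c1) -> (forall p, P p -> dot u2 p <= c2) ->
  S = [set x | P x /\ dot u1 x = c1] -> S = [set x | P x /\ dot u2 x = c2] ->
  exists2 k : R, 0 < k & u2 = k *: u1.
Proof.
move=> [_ [_ [_ _ _ [x [y [Sx Sy xy]]]]]] u10 u20 P1 P2 S1 S2.
have [Px x1] : P x /\ dot u1 x = c1 by move: Sx; rewrite S1.
have [_ x2] : P x /\ dot u2 x = c2 by move: Sx; rewrite S2.
have [_ y1] : P y /\ dot u1 y = c1 by move: Sy; rewrite S1.
have [_ y2] : P y /\ dot u2 y = c2 by move: Sy; rewrite S2.
have [||k k0 kE] := @parallel_normal R u1 u2 x y u10 u20 (introN eqP xy).
- by rewrite x1.
- by rewrite x2.
exists k => //; rewrite lt_def k0 /= leNgt; apply/negP => k_lt0.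
have [q0 Oq0] := O_neq0.
have := open_lt_bound open_polygon u10 (fun p Op => P1 p (open_polyhedron_sub Op)) Oq0.
have := open_lt_bound open_polygon u20 (fun p Op => P2 p (open_polyhedron_sub Op)) Oq0.
by rewrite -x1 -x2 kE !dotZl; nra.
Qed.

(** If there were at most two sides, some direction would make an obtuse or right
    angle with both of their outer normals, against [exposed_side]. *)
Lemma three_sides : exists f : 'I_3 -> set (plane R),
  injective f /\ forall i, is_side P (f i).
Proof.
have v1 : ((1, 0) : plane R) != 0 by rewrite plane_neq0 /= oner_neq0.
have nz v w : 0 < dot v w -> v != 0.
  by apply: contraTneq => ->; rewrite /dot /= !mul0r addr0 ltxx.
have [S1 [u1 [c1 [sS1 uv1 P1 S1E]]]] := exposed_side v1.
have u10 := nz _ _ uv1.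
have nu10 : - u1 != 0 by rewrite oppr_eq0.
have [S2 [u2 [c2 [sS2 uv2 P2 S2E]]]] := exposed_side nu10.
have u20 := nz _ _ uv2.
have [v3 v30 [u1v3 u2v3]] : exists2 v3, v3 != 0 & dot u1 v3 = 0 /\ dot u2 v3 <= 0.
  have w0 : perp u1 != 0 by rewrite plane_neq0 !perpE oppr_eq0 orbC -plane_neq0.
  have [h|h] := leP (dot u2 (perp u1)) 0.
    by exists (perp u1) => //; split => //; exact: dot_perp.
  exists (- perp u1); first by rewrite oppr_eq0.
  by rewrite !dotNr dot_perp oppr0 oppr_le0 ltW.
have [S3 [u3 [c3 [sS3 uv3 P3 S3E]]]] := exposed_side v30.
have u30 := nz _ _ uv3.
have S12 : S1 <> S2.
  move=> E; rewrite -E in S2E.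
  have [k k0 kE] := same_side_normal sS1 u10 u20 P1 P2 S1E S2E.
  by move: uv2; rewrite kE dotNr dotZl oppr_gt0; have := dot_gt0 u10; nra.
have S13 : S1 <> S3.
  move=> E; rewrite -E in S3E.
  have [k k0 kE] := same_side_normal sS1 u10 u30 P1 P3 S1E S3E.
  by move: uv3; rewrite kE dotZl u1v3 mulr0 ltxx.
have S23 : S2 <> S3.
  move=> E; rewrite -E in S3E.
  have [k k0 kE] := same_side_normal sS2 u20 u30 P2 P3 S2E S3E.
  by move: uv3; rewrite kE dotZl; nra.
exists (fun i : 'I_3 => if val i == 0%N then S1 else if val i == 1%N then S2 else S3).
split=> [[[|[|[|//]]] /= hi] [[|[|[|//]]] /= hj] E|[[|[|[|//]]] /= hi]] //;
  by [apply/val_inj|exfalso; move: E; auto|exfalso; symmetry in E; auto].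
Qed.

(** The number [n] is only bounded by the number of constraints, as several
    constraints may define the same side and some may define none. *)
Lemma polygon_ngon (D : {set J}) :
  (forall S, is_side P S -> exists2 a, a \in D &
     S = [set x | P x /\ dot (u a) x = c a]) ->
  exists n, [/\ (3 <= n)%N, (n <= #|D|)%N & is_ngon n P].
Proof.
move=> HD.
pose line (a : J) := [set x | P x /\ dot (u a) x = c a].
have sub : [set S | is_side P S] `<=` line @` [set` D].
  by move=> S /HD[a aD ->]; exists a.
have fin : finite_set [set S | is_side P S].
  by apply: sub_finite_set sub _; apply: finite_image; exact: finite_finset.
have [n nE] := fin; have /card_set_bijP[f [fsub finj fsurj]] := card_esym nE.
exists n; split; last first.
- split => //; split; first exact: polygon_body.
  by exists corners; [exact: finite_corners|exact: polygon_hull].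
- have /choice[g gP] : forall i : 'I_n, exists a, a \in D /\ f i = line a.
    by move=> i; have /HD[a aD fa] := fsub i (ltn_ord i); exists a.
  have ginj : injective g.
    move=> i j gij; apply/val_inj/finj; rewrite ?inE; try exact: ltn_ord.
    by rewrite (gP i).2 (gP j).2 gij.
  rewrite -[n in (n <= _)%N]card_ord -(card_imset _ ginj); apply: subset_leq_card.
  by apply/fintype.subsetP => _ /imsetP[i _ ->]; exact: (gP i).1.
- have [h [hinj hP]] := three_sides.
  have /choice[g gP] : forall i : 'I_3, exists k : 'I_n, f k = h i.
    by move=> i; have [k kn fk] := fsurj _ (hP i); exists (Ordinal kn).
  have ginj : injective g by move=> i j gij; apply: hinj; rewrite -!gP gij.
  by have := leq_card g ginj; rewrite !card_ord.
Qed.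

End Polygon.

(** * The number of sides of a maximal packing *)

Section MaximalPacking.
Context {R : realType} (I : finType) (O : I -> set (plane R)).
Hypothesis packO : convex_packing O.
Hypothesis O_neq0 : forall i, O i !=set0.
Hypothesis maxO : forall i X, open X -> convex X -> O i `<=` X ->
  (forall j, j != i -> X `&` O j = set0) -> X `<=` O i.

(** The closure of [X], when [X] is a nonempty open convex set. *)
Definition hull_of (X : set (plane R)) : set (plane R) :=
  [set p | forall q t, X q -> 0 < t -> t <= 1 -> X (p + t *: (q - p))].

Let separators : exists uc : I -> I -> plane R * R,
  [/\ forall i, uc i i = (0, 1), forall i j, i != j -> (uc i j).1 != 0,
      forall i j p, O i p -> dot (uc i j).1 p < (uc i j).2 &
      forall i j p, i != j -> O j p -> (uc i j).2 < dot (uc i j).1 p].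
Proof.
have [oO cO dO] := packO.
have sep (ij : I * I) : exists l : plane R * R,
  [/\ ij.1 = ij.2 -> l = (0, 1), ij.1 != ij.2 -> l.1 != 0,
   forall p, O ij.1 p -> dot l.1 p < l.2 &
   forall p, ij.1 != ij.2 -> O ij.2 p -> l.2 < dot l.1 p].
  case: ij => i j /=; have [->|ij] := eqVneq i j.
    by exists (0, 1); split => // p _; rewrite /dot /= !mul0r addr0 ltr01.
  have [u [c [u0 h1 h2]]] := open_convex_separation (oO i) (oO j) (cO i) (cO j)
    (O_neq0 i) (O_neq0 j) (dO i j ij).
  exists (u, c); split => // [ij'|p _]; last exact: h2.
  by rewrite ij' eqxx in ij.
have [f fP] := choice sep.
exists (fun i j => f (i, j)); split.
- by move=> i; have [+ _ _ _] := fP (i, i); apply.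
- by move=> i j ij; have [_ + _ _] := fP (i, j); apply.
- by move=> i j; have [_ _ + _] := fP (i, j).
- by move=> i j p ij; have [_ _ _ +] := fP (i, j); apply.
Qed.

(** A vertical direction [(- s, 1)] that is parallel to none of the separating
    lines. *)
Let generic (uc : I -> I -> plane R * R) :
  (forall i j, i != j -> (uc i j).1 != 0) ->
  exists s : R, forall i j, i != j -> dot (uc i j).1 (- s, 1) != 0.
Proof.
move=> uc0.
have [s [_ _ sP]] := avoid_seq
  [seq (uc ij.1 ij.2).1.2 / (uc ij.1 ij.2).1.1 | ij : I * I] (@ltr01 R).
exists s => i j ij; apply: contra sP => /eqP; rewrite /dot /= mulr1 mulrN => h.
have {h} h : (uc i j).1.2 = (uc i j).1.1 * s by apply/eqP; rewrite -subr_eq0 addrC h.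
have u1 : (uc i j).1.1 != 0.
  apply/eqP => u1; have := uc0 i j ij.
  by rewrite plane_neq0 h u1 mul0r eqxx.
apply/mapP; exists (i, j); first by rewrite mem_enum.
by rewrite /= h mulrAC mulfV// mul1r.
Qed.

(** Separating lines between [O i] and every other [O j] bound a convex set that
    contains [O i] and avoids the others; by maximality it is [O i], so the closure
    of [O i] is a polygon whose sides lie on separating lines, none of which is
    vertical.  The same argument works with fewer lines.  Keep the separating lines
    between [O i] and the sets that are directly above or below it on some vertical
    line, and the two vertical lines that bound the projection of [O i]: a vertical
    line that meets both [O i] and the resulting set meets first, on either side of
    [O i], one of the retained lines, and the other sets lie beyond it.  Thus every
    side lies on one of the new lines, and since it is not vertical it comes from a
    vertical neighbour.  So [n i] can be the number of vertical neighbours of [O i],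
    and the neighbours are counted by [line_consecutive_le]. *)
Theorem maximal_packing_polygons : exists n : I -> nat,
  (\sum_i n i <= 6 * #|I|)%N /\
  forall i, bnd (O i) ->
    exists m, [/\ (3 <= m)%N, (m <= n i)%N, is_ngon m (hull_of (O i)) &
      closed (hull_of (O i))].
Proof.
have [oO cO dO] := packO.
have [uc [ucii uc0 ucl ucr]] := separators.
have [s sP] := generic uc0.
(* d is the vertical direction and e the functional constant along it *)
pose d : plane R := (- s, 1).
pose e : plane R := (1, s).
pose pt (x y : R) : plane R := (x - s * y, y).
have ptE p : p = pt (dot e p) p.2.
  by apply/plane_eqP; rewrite /pt /dot /=; split => //; ring.
have dot_pt u x y y' : dot u (pt x y') - dot u (pt x y) = (y' - y) * dot u d.
  by rewrite /dot /pt /d /=; ring.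
pose act x : pred I := fun i => `[< exists y, O i (pt x y) >].
pose y x i := xget 0 [set y | O i (pt x y)].
have yP x i : act x i -> O i (pt x (y x i)).
  by move=> /asboolP; rewrite /y => h; case: xgetP => [z _ //|h']; case: h => z /h'.
pose above : rel I := fun i j => 0 < dot (uc i j).1 d.
have order_pt x i j z z' : i != j -> O i (pt x z) -> O j (pt x z') ->
    0 < (z' - z) * dot (uc i j).1 d.
  move=> ij Oz Oz'; rewrite -(dot_pt _ x) subr_gt0.
  exact: lt_trans (ucl i j _ Oz) (ucr i j _ ij Oz').
have aboveE' x i j z z' : i != j -> O i (pt x z) -> O j (pt x z') ->
    above i j = (z < z').
  move=> ij Oz Oz'; have := order_pt _ _ _ _ _ ij Oz Oz'; rewrite /above => h.
  apply/idP/idP => h'.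
    by move: h; rewrite pmulr_lgt0// subr_gt0.
  by move: h; rewrite pmulr_rgt0// subr_gt0.
have above_irr i : above i i = false.
  by rewrite /above ucii /dot /= !mul0r addr0 ltxx.
have aboveE x i j : act x i -> act x j -> above i j = (y x i < y x j).
  move=> /yP ai /yP aj; have [->|ij] := eqVneq i j; first by rewrite above_irr ltxx.
  exact: (aboveE' x).
have y_neq x i j : act x i -> act x j -> i != j -> y x i != y x j.
  move=> /yP ai /yP aj ij; have := order_pt _ _ _ _ _ ij ai aj.
  by apply: contraTneq => ->; rewrite subrr mul0r ltxx.
have O_itv i x1 x2 x3 : x1 <= x2 -> x2 <= x3 -> act x1 i -> act x3 i -> act x2 i.
  move=> x12 x23 /asboolP[y1 O1] /asboolP[y3 O3].
  have [x13|x13] := eqVneq x1 x3.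
    have -> : x2 = x1 by lra.
    by apply/asboolP; exists y1.
  have x13' : 0 < x3 - x1 by rewrite subr_gt0 lt_neqAle x13 (le_trans x12).
  pose t := (x2 - x1) / (x3 - x1).
  have t0 : 0 <= t by rewrite divr_ge0 ?subr_ge0 ?(le_trans x12).
  have t1 : t <= 1 by rewrite ler_pdivrMr// mul1r lerD2r.
  have /convexP/(_ _ _ t O1 O3 t0 t1) := cO i.
  move=> h; apply/asboolP; exists (y1 + t * (y3 - y1)); move: h; congr (O i).
  apply/plane_eqP; rewrite !plane_coordE /pt /=; split => //.
  have -> : x2 = x1 + t * (x3 - x1) by rewrite /t divfK; [ring|rewrite gt_eqF].
  by ring.
pose V := [set p : I * I | `[< exists x, consecutive above (act x) p.1 p.2 >]]%SET.
have VP i j : reflect (exists x, consecutive above (act x) i j) ((i, j) \in V).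
  by rewrite inE; exact: asboolP.
have cardV : (#|V| <= 3 * #|I|)%N.
  apply: (line_consecutive_le O_itv aboveE y_neq) => -[i j] /VP.
  exact.
pose D i := [set j | ((i, j) \in V) || ((j, i) \in V)]%SET.
exists (fun i => #|D i|); split.
  have sum1 : (\sum_i #|[set j | (i, j) \in V]%SET| = #|V|)%N.
    rewrite -[RHS]sum1_card (eq_bigr (fun i => \sum_(j | (i, j) \in V) 1)%N).
      by rewrite pair_big_dep /=; apply: eq_bigl => -[].
    by move=> i _; rewrite sum1dep_card.
  have sum2 : (\sum_i #|[set j | (j, i) \in V]%SET| = #|V|)%N.
    rewrite -[RHS]sum1_card (eq_bigr (fun i => \sum_(j | (j, i) \in V) 1)%N).
      rewrite (exchange_big_dep predT)//= pair_big_dep /=.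
      by apply: eq_bigl => -[].
    by move=> i _; rewrite sum1dep_card.
  apply: (@leq_trans (\sum_i (#|[set j | (i, j) \in V]%SET| +
                              #|[set j | (j, i) \in V]%SET|)%N)).
    apply: leq_sum => i _; apply: leq_trans (leq_card_setU _ _).
    by apply: subset_leq_card; apply/fintype.subsetP => j; rewrite !inE.
  rewrite big_split/= sum1 sum2 addnn -mul2n -[6%N]/(2 * 3)%N -mulnA leq_mul2l.
  exact: cardV.
move=> i [M PM].
pose L := constraints (fun j => (uc i j).1) (fun j => (uc i j).2).
have LE p : open_polyhedron L p <-> forall j, dot (uc i j).1 p < (uc i j).2.
  split=> [Lp j|Lp _ [j _ <-]]; last exact: Lp.
  by apply: (Lp ((uc i j).1, (uc i j).2)); exists j.
have OL : O i = open_polyhedron L.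
  apply/seteqP; split=> [p Op|]; first by apply/LE => j; exact: ucl.
  apply: maxO.
  - exact: open_polygon.
  - by apply: convex_open_polyhedron.
  - by move=> p Op; apply/LE => j; exact: ucl.
  - move=> j ji; rewrite -subset0 => p [/LE/(_ j) + Op].
    by rewrite eq_sym in ji; move=> /(lt_trans (ucr _ _ _ ji Op)); rewrite ltxx.
have L0 : open_polyhedron L !=set0 by rewrite -OL.
pose fO := [set dot e p | p in O i].
have e0 : e != 0 by rewrite plane_neq0 /= oner_neq0.
have fOb p : O i p -> `|dot e p| <= M + `|s| * M.
  move=> /PM[h1 h2]; rewrite /dot /= mul1r; apply: le_trans (ler_normD _ _) _.
  by rewrite lerD// normrM ler_wpM2l.
have [p0 Op0] := O_neq0 i.
have supfO : has_sup fO.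
  split; first by exists (dot e p0), p0.
  by exists (M + `|s| * M) => _ [p Op <-]; apply: le_trans (ler_norm _) (fOb p Op).
have inffO : has_inf fO.
  split; first by exists (dot e p0), p0.
  by exists (- (M + `|s| * M)) => _ [p Op <-]; move: (fOb p Op); rewrite ler_norml => /andP[].
have ltsup p : O i p -> dot e p < sup fO.
  apply: (open_lt_bound (oO i) e0) => q Oq; apply: ub_le_sup; first by case: supfO.
  by exists q.
have gtinf p : O i p -> inf fO < dot e p.
  have ne0 : - e != 0 by rewrite oppr_eq0.
  move=> Op; rewrite -ltrN2 -dotNl; apply: (open_lt_bound (oO i) ne0) Op => q Oq.
  rewrite dotNl lerN2; apply: ge_inf; first by case: inffO.
  by exists q.
have act_mid x : inf fO < x -> x < sup fO -> act x i.
  move=> h1 h2.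
  have [_ [p1 Op1 <-] p1x] := inf_adherent (eps := x - inf fO) ltac:(by rewrite subr_gt0) inffO.
  have [_ [p2 Op2 <-] p2x] := sup_adherent (eps := sup fO - x) ltac:(by rewrite subr_gt0) supfO.
  apply: (@O_itv i (dot e p1) x (dot e p2)).
  - by move: p1x; rewrite addrC subrK => /ltW.
  - by move: p2x; rewrite opprB addrC subrK => /ltW.
  - by apply/asboolP; exists p1.2; rewrite -ptE.
  - by apply/asboolP; exists p2.2; rewrite -ptE.
(* the second description of O i; the constraint 0 < 1 stands for the indices that
   are not neighbours *)
pose u2 (a : I + bool) := match a with
  | inl j => if j \in D i then (uc i j).1 else 0
  | inr b => if b then e else - e end.
pose c2 (a : I + bool) := match a with
  | inl j => if j \in D i then (uc i j).2 else 1
  | inr b => if b then sup fO else - inf fO end.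
pose L2 := constraints u2 c2.
have L2E p : open_polyhedron L2 p <-> [/\ forall j, j \in D i -> dot (uc i j).1 p < (uc i j).2,
    inf fO < dot e p & dot e p < sup fO].
  split=> [Lp|[Lp hi hs] _ [[j|[]] _ <-] /=].
  - split.
    + move=> j jD; have := Lp (u2 (inl j), c2 (inl j)); rewrite /u2 /c2 jD.
      by apply; exists (inl j) => //; rewrite /u2 /c2 jD.
    + have := Lp (- e, - inf fO); rewrite dotNl ltrN2; apply.
      by exists (inr false).
    + by apply: (Lp (e, sup fO)); exists (inr true).
  - by case: ifP => [/Lp//|_]; rewrite /dot /= !mul0r addr0 ltr01.
  - exact: hs.
  - by rewrite dotNl ltrN2.
have OL2 : O i = open_polyhedron L2.
  apply/seteqP; split=> [p Op|].
    by apply/L2E; split; [move=> j _; exact: ucl|exact: gtinf|exact: ltsup].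
  apply: maxO.
  - exact: open_polygon.
  - exact: convex_open_polyhedron.
  - move=> p Op; apply/L2E; split; [move=> j _; exact: ucl|exact: gtinf|exact: ltsup].
  - move=> l li; rewrite -subset0 => p [/L2E[Lp hi hs] Op].
    set x := dot e p in hi hs.
    have ai := act_mid x hi hs.
    have al : act x l by apply/asboolP; exists p.2; rewrite -ptE.
    have Oiy := yP _ _ ai.
    have Olp : O l (pt x p.2) by rewrite -ptE.
    have below j : j \in D i -> j != i -> act x j -> (p.2 < y x j) = above i j.
      move=> jD ji /yP Oj; rewrite eq_sym in ji.
      have : 0 < dot (uc i j).1 (pt x (y x j)) - dot (uc i j).1 (pt x p.2).
        by rewrite subr_gt0 -ptE; apply: lt_trans (Lp j jD) (ucr _ _ _ ji Oj).
      rewrite dot_pt /above => h; apply/idP/idP => h'.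
        by move: h; rewrite pmulr_rgt0// subr_gt0.
      by move: h; rewrite pmulr_lgt0// subr_gt0.
    have ly j : act x j -> j != l -> above j l = (y x j < p.2).
      by move=> /yP Oj jl; exact: (aboveE' x).
    have yl j : act x j -> j != l -> above l j = (p.2 < y x j).
      by move=> /yP Oj jl; apply: (aboveE' x) => //; rewrite eq_sym.
    have nlD : l \in D i -> False.
      move=> lD; have := Lp l lD; rewrite eq_sym in li.
      by move=> /(lt_trans (ucr _ _ _ li Op)); rewrite ltxx.
    have yil := y_neq _ _ _ ai al; rewrite eq_sym in li.
    have := yil li; rewrite neq_lt -!aboveE// => /orP[il|li'].
      have [j cj jl] := exists_consecutive (@aboveE x) (@y_neq x) ai al il.
      have jD : j \in D i by rewrite inE; apply/orP; left; apply/VP; exists x.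
      have [jE|jl'] := eqVneq j l; first by apply: nlD; rewrite -jE.
      case: jl => [jE|jl]; first by rewrite jE eqxx in jl'.
      have /consecutiveP[_ aj ij _] := cj.
      have ji : j != i by apply: contraTneq ij => ->; rewrite above_irr.
      move: ij jl; rewrite -below// ly// => h1 h2.
      by have := lt_trans h1 h2; rewrite ltxx.
    have [j cj jl] := exists_consecutive_below (@aboveE x) (@y_neq x) ai al li'.
    have jD : j \in D i by rewrite inE; apply/orP; right; apply/VP; exists x.
    have [jE|jl'] := eqVneq j l; first by apply: nlD; rewrite -jE.
    case: jl => [jE|lj]; first by rewrite jE eqxx in jl'.
    have /consecutiveP[aj _ ji' _] := cj.
    have ji : j != i by apply: contraTneq ji' => ->; rewrite above_irr.
    have := below j jD ji aj; rewrite -yl// lj => /esym.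
    by move: ji'; rewrite !(aboveE x)// => h1 /(lt_trans h1); rewrite ltxx.
have PE : hull_of (O i) = closed_polyhedron L by rewrite closed_polyhedronE// /hull_of OL.
have PL2 : closed_polyhedron L = closed_polyhedron L2 by apply: closed_polyhedron_eq => //; rewrite -OL.
have Pb : bnd (closed_polyhedron L).
  exists (M + M + M) => p; rewrite -PE => /(_ p0 2^-1 Op0).
  rewrite invr_gt0 ltr0n => /(_ isT); have h : 2^-1 <= 1 :> R by lra.
  move=> /(_ h)/PM[]; have [] := PM _ Op0; rewrite !plane_coordE !ler_norml.
  by move=> /andP[? ?] /andP[? ?] /andP[? ?] /andP[? ?]; split; apply/andP; split; lra.
have [|m [m3 mD ngon]] := polygon_ngon L0 Pb (D := D i); last first.
  exists m; split => //; first by rewrite PE.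
  by rewrite PE; exact: closed_polygon.
move=> S sS; have oL : open (open_polyhedron L) by exact: open_polygon.
have [l1 [Ll1 l10 S1 _]] := side_constraint oL L0 sS.
rewrite -/L PL2 in sS.
have oL2 : open (open_polyhedron L2) by exact: open_polygon.
have L20 : open_polyhedron L2 !=set0 by rewrite -OL2.
have [l2 [Ll2 l20 S2 [a [b [Sa Sb ab]]]]] := side_constraint oL2 L20 sS.
case: Ll2 => -[j|c] _ l2E.
  exists j; first by apply: contraNT l20 => /negPf jD; rewrite -l2E /= jD.
  move: l20; rewrite S2 -/L PL2 -l2E /=; case: ifP => [//|_].
  by rewrite eqxx.
(* a side on a vertical line would also lie on a separating line *)
exfalso.
have eab : dot e a = dot e b.
  have [[_ a2] [_ b2]] : (closed_polyhedron L2 a /\ dot l2.1 a = l2.2) /\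
      (closed_polyhedron L2 b /\ dot l2.1 b = l2.2).
    by split; [move: Sa|move: Sb]; rewrite S2.
  move: a2 b2; rewrite -l2E /=; case: c {l2E} => /= [-> ->//|].
  by rewrite !dotNl => <- /oppr_inj.
have [j _ l1E] := Ll1.
have ji : i != j.
  by apply: contraNneq l10 => ij; rewrite -l1E /= -ij ucii.
have [[_ a1] [_ b1]] : (closed_polyhedron L a /\ dot l1.1 a = l1.2) /\
      (closed_polyhedron L b /\ dot l1.1 b = l1.2).
  by split; [move: Sa|move: Sb]; rewrite S1.
have : dot l1.1 (pt (dot e a) b.2) - dot l1.1 (pt (dot e a) a.2) = 0.
  by rewrite -ptE eab -ptE a1 b1 subrr.
rewrite dot_pt -l1E /= => /eqP; rewrite mulf_eq0 (negPf (sP _ _ ji)) orbF subr_eq0.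
move=> /eqP ba; apply: ab; rewrite (ptE a) (ptE b) eab; congr pt.
by rewrite ba.
Qed.

End MaximalPacking.

(** * Lebesgue measure of the plane under homotheties *)

HB.instance Definition _ (R : realType) := Measure.copy (@leb2 R)
  (@lebesgue_measure R \x @lebesgue_measure R)%E.

Section Area.
Context {R : realType}.
Local Notation mplane := (measurableTypeR R * measurableTypeR R)%type.
Implicit Types (A B O : set (plane R)).

Definition borel A : Prop := measurable (A : set mplane).

Lemma borel_box (i j : interval R) : borel ([set` i] `*` [set` j]).
Proof. by apply: measurableX; exact: measurable_itv. Qed.

(** An open set is a union of boxes with rational vertices. *)
Lemma open_borel O : open O -> borel O.
Proof.
move=> /openP oO.
pose box (k : rat * rat * rat * rat) : set (plane R) :=
  [set` `]ratr k.1.1.1, ratr k.1.1.2[ ] `*` [set` `]ratr k.1.2, ratr k.2[ ].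
have -> : O = \bigcup_(k in [set k | box k `<=` O]) box k.
  apply/seteqP; split => [p Op|p [k kO kp]]; last exact: kO.
  have [e e0 He] := oO p Op.
  have [a] := @rat_in_itvoo R (p.1 - e) p.1 ltac:(by rewrite gtrBl).
  have [b] := @rat_in_itvoo R p.1 (p.1 + e) ltac:(by rewrite ltrDl).
  have [c] := @rat_in_itvoo R (p.2 - e) p.2 ltac:(by rewrite gtrBl).
  have [d] := @rat_in_itvoo R p.2 (p.2 + e) ltac:(by rewrite ltrDl).
  rewrite !in_itv /= => /andP[d1 d2] /andP[c1 c2] /andP[b1 b2] /andP[a1 a2].
  exists (a, b, c, d) => /=.
    move=> q [/=]; rewrite !in_itv /= => /andP[? ?] /andP[? ?].
    by apply: He; rewrite ltr_norml; apply/andP; split; lra.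
  by split; rewrite /= in_itv /=; apply/andP.
rewrite /borel bigcup_mkcond; apply: countable_bigcupT_measurable => // k.
case: ifP => _; [exact: borel_box|exact: measurable0].
Qed.

Lemma closed_borel A : closed A -> borel A.
Proof.
by move=> cA; rewrite -[A]setCK; apply: measurableC; apply: open_borel; rewrite openC.
Qed.

Lemma leb2_box (a b c d : R) (x y z w : bool) : a <= b -> c <= d ->
  leb2 ([set` Interval (BSide x a) (BSide y b)] `*`
        [set` Interval (BSide z c) (BSide w d)]) = ((b - a) * (d - c))%:E.
Proof.
move=> ab cd; rewrite /leb2 product_measure1E//=; try exact: measurable_itv.
rewrite !lebesgue_measure_itv /= !lte_fin.
have -> : (if (a < b)%R then b%:E - a%:E else 0%E)%E = (b - a)%:E.
  by case: ltgtP ab => // -> _; rewrite subrr.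
have -> : (if (c < d)%R then d%:E - c%:E else 0%E)%E = (d - c)%:E.
  by case: ltgtP cd => // -> _; rewrite subrr.
by rewrite EFinM.
Qed.

Lemma leb2_bounded_lty A (M : R) : borel A ->
  (forall p, A p -> `|p.1| <= M /\ `|p.2| <= M) -> (leb2 A < +oo)%E.
Proof.
move=> bA AM; have [M0|M0] := ltP M 0.
  have -> : A = set0.
    by rewrite -subset0 => p /AM[+ _]; move=> /le_lt_trans/(_ M0); rewrite normr_lt0.
  by rewrite measure0.
pose B := @cbox R M.
apply: (@le_lt_trans _ _ (leb2 B)).
  apply: le_measure; rewrite ?inE//; first exact: borel_box.
  by move=> p /AM/cboxP.
by rewrite /B /cbox leb2_box ?ltry// ge0_cp.
Qed.

End Area.

Section Homothety.
Context {R : realType} (v t : R).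
Local Notation mR := (measurableTypeR R).

Definition homothety1 : mR -> mR := fun x => v + t * x.

Lemma measurable_homothety1 : measurable_fun setT homothety1.
Proof. exact: measurable_funD. Qed.

Definition homothety1_measure : set mR -> \bar R :=
  pushforward lebesgue_measure homothety1.

HB.instance Definition _ := Measure.copy homothety1_measure
  (measure_function_pushforward__canonical__measure_function_Measure
     lebesgue_measure measurable_homothety1).

(** Both sides of the equation define measures that agree on half-open
    intervals. *)
Lemma lebesgue_homothety1 (A : set R) : 0 < t -> measurable (A : set mR) ->
  lebesgue_measure (homothety1 @^-1` A) = (t^-1%:E * lebesgue_measure A)%E.
Proof.
move=> t0 mA; have tge : 0 <= t by exact: ltW.
have -> : lebesgue_measure A = mscale (NngNum tge) homothety1_measure A.
  apply: lebesgue_measure_unique => // _ [[a b]] _ <-.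
  transitivity (t%:E * lebesgue_measure (homothety1 @^-1` [set` `]a, b]]))%E; last by [].
  have -> : homothety1 @^-1` [set` `]a, b]] = [set` `](a - v) / t, (b - v) / t]].
    apply/seteqP; split => x; rewrite /homothety1 /= !in_itv /=.
      by rewrite ltr_pdivrMr// ler_pdivlMr// => /andP[? ?]; apply/andP; split; lra.
    by rewrite ltr_pdivrMr// ler_pdivlMr// => /andP[? ?]; apply/andP; split; lra.
  rewrite !lebesgue_measure_itv /= !lte_fin ltr_pM2r ?invr_gt0// ltrD2r.
  case: ifP => _; last by rewrite mule0.
  by rewrite -!EFinB -EFinM; congr EFin; field; rewrite gt_eqF.
transitivity (t^-1%:E * (t%:E * lebesgue_measure (homothety1 @^-1` A)))%E; last by [].
by rewrite muleA -EFinM mulVf ?gt_eqF// mul1e.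
Qed.

End Homothety.

Section PlaneHomothety.
Context {R : realType} (v : plane R) (t : R).
Local Notation mplane := (measurableTypeR R * measurableTypeR R)%type.

Definition homothety : mplane -> mplane := fun p => v + t *: (p : plane R).

Lemma measurable_homothety : measurable_fun setT homothety.
Proof.
apply/measurable_fun_pairP; split.
  exact: (measurableT_comp (measurable_homothety1 v.1 t) measurable_fst).
exact: (measurableT_comp (measurable_homothety1 v.2 t) measurable_snd).
Qed.

Definition homothety_measure : set mplane -> \bar R := pushforward leb2 homothety.

HB.instance Definition _ := Measure.copy homothety_measure
  (measure_function_pushforward__canonical__measure_function_Measure
     leb2 measurable_homothety).

(** The product measure is characterised by its values on rectangles. *)
Lemma leb2_homothety (A : set (plane R)) : 0 < t -> borel A ->
  leb2 (homothety @^-1` A) = ((t ^+ 2)^-1%:E * leb2 A)%E.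
Proof.
move=> t0 mA; have tge : 0 <= t ^+ 2 by exact: sqr_ge0.
have -> : leb2 A = mscale (NngNum tge) homothety_measure A.
  apply: product_measure_unique => // B C mB mC.
  transitivity ((t ^+ 2)%:E * leb2 (homothety @^-1` (B `*` C)))%E; first by [].
  have -> : homothety @^-1` (B `*` C) =
      (homothety1 v.1 t @^-1` B) `*` (homothety1 v.2 t @^-1` C) by [].
  rewrite /leb2 product_measure1E//=; last 2 first.
  - by rewrite -[X in measurable X]setTI; exact: measurable_homothety1.
  - by rewrite -[X in measurable X]setTI; exact: measurable_homothety1.
  rewrite !lebesgue_homothety1//.
  rewrite [X in (_ * X)%E]muleACA -EFinM [LHS]muleA -EFinM.
  have -> : t ^+ 2 * (t^-1 * t^-1) = 1 by rewrite -expr2 -exprMn mulfV ?gt_eqF// expr1n.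
  by rewrite mul1e.
transitivity ((t ^+ 2)^-1%:E * ((t ^+ 2)%:E * leb2 (homothety @^-1` A)))%E; last by [].
by rewrite muleA -EFinM mulVf ?gt_eqF ?exprn_gt0// mul1e.
Qed.

End PlaneHomothety.

(** * Areas of bounded Borel sets *)

Section RealArea.
Context {R : realType}.
Local Notation mplane := (measurableTypeR R * measurableTypeR R)%type.
Implicit Types (A B O : set (plane R)) (v : plane R).

Lemma leb2_area A : borel A -> bnd A -> leb2 A = (area A)%:E.
Proof.
move=> bA [M AM]; rewrite /area fineK// ge0_fin_numE//.
exact: leb2_bounded_lty AM.
Qed.

Lemma area_ge0 A : 0 <= area A.
Proof. by rewrite /area fine_ge0. Qed.

Lemma le_area A B : borel A -> borel B -> bnd B -> A `<=` B -> area A <= area B.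
Proof.
move=> bA bB nB AB; have nA := bndS AB nB.
by rewrite -lee_fin -!leb2_area//; apply: le_measure; rewrite ?inE.
Qed.

Lemma borelU A B : borel A -> borel B -> borel (A `|` B).
Proof. exact: measurableU. Qed.

Lemma borelI A B : borel A -> borel B -> borel (A `&` B).
Proof. exact: measurableI. Qed.

Lemma borelD A B : borel A -> borel B -> borel (A `\` B).
Proof. exact: measurableD. Qed.

Lemma area0 : area (set0 : set (plane R)) = 0.
Proof. by rewrite /area measure0. Qed.

Lemma areaU A B : borel A -> borel B -> bnd A -> bnd B -> A `&` B = set0 ->
  area (A `|` B) = area A + area B.
Proof.
move=> bA bB nA nB AB; apply: EFin_inj.
by rewrite EFinD -!leb2_area ?measureU//; [exact: borelU|exact: bndU].
Qed.

Lemma area_subU A B : borel A -> borel B -> bnd A -> bnd B ->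
  area (A `|` B) <= area A + area B.
Proof.
move=> bA bB nA nB; rewrite -lee_fin EFinD -!leb2_area ?measureU2//.
  exact: borelU.
exact: bndU.
Qed.

Section Families.
Variables (I : choiceType) (F : I -> set (plane R)).
Hypothesis bF : forall i, borel (F i).
Hypothesis nF : forall i, bnd (F i).

Lemma big_borel_bnd (r : seq I) :
  borel (\big[setU/set0]_(i <- r) F i) /\ bnd (\big[setU/set0]_(i <- r) F i).
Proof.
elim: r => [|i r [IH1 IH2]]; first by rewrite big_nil; split; [exact: measurable0|exact: bnd0].
by rewrite big_cons; split; [exact: borelU|exact: bndU].
Qed.

Lemma area_sum (r : seq I) : uniq r -> (forall i j, i != j -> F i `&` F j = set0) ->
  \sum_(i <- r) area (F i) = area (\big[setU/set0]_(i <- r) F i).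
Proof.
move=> ur dF; elim: r ur => [_|i r IH /= /andP[ir ur]]; first by rewrite !big_nil area0.
have [b n] := big_borel_bnd r.
rewrite !big_cons IH// areaU//.
rewrite -subset0 => p [Fp]; rewrite -bigcup_seq => -[j jr Fj].
have ij : i != j by apply: contraNneq ir => ->.
by rewrite -(dF i j ij).
Qed.

Lemma area_sub_sum (r : seq I) :
  area (\big[setU/set0]_(i <- r) F i) <= \sum_(i <- r) area (F i).
Proof.
elim: r => [|i r IH]; first by rewrite !big_nil area0.
have [b n] := big_borel_bnd r.
by rewrite !big_cons; apply: le_trans (area_subU _ _ _ _) _ => //; rewrite lerD2l.
Qed.

End Families.

Lemma area_sum_le (I : finType) (F : I -> set (plane R)) B : borel B -> bnd B ->
  (forall i, borel (F i)) -> (forall i, F i `<=` B) ->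
  (forall i j, i != j -> F i `&` F j = set0) -> \sum_i area (F i) <= area B.
Proof.
move=> bB nB bF FB dF.
have nF i : bnd (F i) by exact: bndS (FB i) nB.
rewrite area_sum//; last exact: index_enum_uniq.
apply: le_area => //; first by case: (big_borel_bnd bF nF (index_enum I)).
by rewrite -bigcup_seq => p [i _ /FB].
Qed.

Lemma area_le_sum (I : choiceType) (F : I -> set (plane R)) (r : seq I) B : borel B ->
  (forall i, borel (F i)) -> (forall i, bnd (F i)) ->
  (forall p, B p -> exists2 i, i \in r & F i p) ->
  area B <= \sum_(i <- r) area (F i).
Proof.
move=> bB bF nF BF; have [b n] := big_borel_bnd bF nF r.
apply: le_trans (area_sub_sum bF nF r); apply: le_area => // p /BF[i ir Fp].
by rewrite -bigcup_seq; exists i.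
Qed.

Lemma homothety_preimage v (t : R) A : 0 < t ->
  [set v + t *: p | p in A] = homothety (- t^-1 *: v) t^-1 @^-1` A.
Proof.
move=> t0; have tn : t != 0 by rewrite gt_eqF.
apply/seteqP; split => [_ [p Ap <-]|p Ap].
  rewrite /homothety /=; move: Ap; congr A.
  by apply/plane_eqP; rewrite !plane_coordE; split; field.
exists (homothety (- t^-1 *: v) t^-1 p) => //.
by apply/plane_eqP; rewrite /homothety !plane_coordE; split; field.
Qed.

Lemma borel_homothety v (t : R) A : 0 < t -> borel A ->
  borel [set v + t *: p | p in A].
Proof.
move=> t0 bA; rewrite homothety_preimage// /borel -[X in measurable X]setTI.
exact: measurable_homothety.
Qed.

Lemma area_homothety v (t : R) A : 0 < t -> borel A ->
  area [set v + t *: p | p in A] = t ^+ 2 * area A.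
Proof.
move=> t0 bA; rewrite homothety_preimage// /area leb2_homothety ?invr_gt0//.
rewrite exprVn invrK; have t2 : (0 < (t ^+ 2)%:E)%E by rewrite lte_fin exprn_gt0.
by case: (leb2 A) => [r| |] //; rewrite ?gt0_muley ?gt0_muleNy//= mulr0.
Qed.

Lemma bnd_homothety v (t : R) A : bnd A -> bnd [set v + t *: p | p in A].
Proof.
move=> [M AM]; exists (`|v.1| + `|v.2| + `|t| * M) => _ [p /AM[h1 h2] <-].
have t1 := ler_wpM2l (normr_ge0 t) h1; have t2 := ler_wpM2l (normr_ge0 t) h2.
rewrite -!normrM in t1 t2; have v1 := normr_ge0 v.1; have v2 := normr_ge0 v.2.
rewrite !plane_coordE; split; apply: le_trans (ler_normD _ _) _; lra.
Qed.

Lemma open_leb2_gt0 O : open O -> O !=set0 -> (0 < leb2 O)%E.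
Proof.
move=> /openP oO [p /oO[e e0 He]].
have e2 : 0 < e / 2 by rewrite divr_gt0.
pose B : set (plane R) := [set` `[p.1, p.1 + e / 2]] `*` [set` `[p.2, p.2 + e / 2]].
apply: (@lt_le_trans _ _ (leb2 B)).
  rewrite leb2_box ?lerDl ?(ltW e2)// lte_fin.
  by rewrite ![_ + _ - _]addrAC !subrr !add0r mulr_gt0.
have BO : B `<=` O.
  move=> q [/=]; rewrite !in_itv /= => /andP[? ?] /andP[? ?].
  by apply: He; rewrite ger0_norm ?subr_ge0//; lra.
apply: le_measure; rewrite ?inE//; first exact: borel_box.
by apply: open_borel; apply/openP.
Qed.

Lemma open_area_gt0 O : open O -> bnd O -> O !=set0 -> 0 < area O.
Proof.
move=> oO nO O0; rewrite -lte_fin -leb2_area//; first exact: open_leb2_gt0.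
exact: open_borel.
Qed.

(** The translates of [A] by [v / (k + 1)] are pairwise disjoint, have the same
    area and stay in a bounded region.  This one argument covers segments in any
    direction and graphs in rotated coordinates, without rotation invariance. *)
Lemma translates_null A v : borel A -> bnd A ->
  (forall p (t : R), 0 < t -> t <= 1 -> A p -> ~ A (p + t *: v)) -> area A = 0.
Proof.
move=> bA nA dA; have [M AM] := nA.
pose F n (k : 'I_n) : set (plane R) := [set (k.+1%:R^-1 *: v) + 1 *: p | p in A].
pose N := M + `|v.1| + `|v.2|.
pose B : set (plane R) := [set` `[- N, N]] `*` [set` `[- N, N]].
have nB : bnd B.
  by exists N => p [/=]; rewrite !in_itv /= !ler_norml.
have bB : borel B by exact: borel_box.
have le n : n%:R * area A <= area B.
  have <- : \sum_(k < n) area (@F n k) = n%:R * area A.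
    rewrite (eq_bigr (fun=> area A)); last first.
      by move=> k _; rewrite area_homothety// expr1n mul1r.
    by rewrite sumr_const card_ord mulr_natl.
  apply: area_sum_le => // [k|k _ [p /AM[h1 h2] <-]|j k jk].
  - exact: borel_homothety.
  - have k0 : 0 <= (k.+1%:R)^-1 :> R by rewrite invr_ge0.
    have k1 : (k.+1%:R)^-1 <= 1 :> R by rewrite invf_le1// ler1n.
    move: (k.+1%:R^-1) k0 k1 => c k0 k1.
    have kv (w : R) : - `|w| <= c * w /\ c * w <= `|w|.
      by apply/andP; rewrite -ler_norml normrM ger0_norm// ler_piMl.
    have [n1 n1'] := kv v.1; have [n2 n2'] := kv v.2.
    have n5 := normr_ge0 v.1; have n6 := normr_ge0 v.2.
    move: h1 h2; rewrite !ler_norml => /andP[h1 h1'] /andP[h2 h2'].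
    by split; rewrite /mkset in_itv !plane_coordE mul1r /N /=; apply/andP; split; lra.
  - rewrite -subset0 => q [[p Ap pE] [p' Ap' pE']].
    wlog jk' : j k p p' jk Ap Ap' pE pE' / (j < k)%N.
      move=> H; have : (j : nat) != k by [].
      by rewrite neq_ltn => /orP[|] h; [exact: (H j k p p')|apply: (H k j p' p) => //; rewrite eq_sym].
    apply: (dA p (j.+1%:R^-1 - k.+1%:R^-1)) => //.
    + by rewrite subr_gt0 ltf_pV2 ?posrE ?ltr0n// ltr_nat.
    + rewrite lerBlDr (@le_trans _ _ 1)//; first by rewrite invf_le1// ler1n.
      by rewrite lerDl invr_ge0.
    + have -> : p + (j.+1%:R^-1 - k.+1%:R^-1) *: v = p' => //.
      move: pE'; rewrite -pE; move: (j.+1%:R^-1) (k.+1%:R^-1) => a b.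
      move=> /plane_eqP; rewrite !plane_coordE => -[e1 e2].
      by apply/plane_eqP; rewrite !plane_coordE; split; lra.
apply/eqP; rewrite eq_le area_ge0 andbT leNgt; apply/negP => A0.
have [n nP] : exists n : nat, area B / area A < n%:R.
  by exists (Num.Def.archi_bound (area B / area A)); apply: archi_boundP; rewrite divr_ge0// area_ge0.
by have := le n; rewrite leNgt -ltr_pdivrMr// nP.
Qed.

End RealArea.

(** * Covering a cluster by polygons with six sides on average *)

Section ClusterPolygons.
Context {R : realType}.
Implicit Types (O E P : set (plane R)) (p q : plane R).

Definition square (r : R) : set (plane R) := [set` `]- r, r[] `*` [set` `]- r, r[].

Lemma squareP r p : square r p <-> [/\ - r < p.1, p.1 < r, - r < p.2 & p.2 < r].
Proof.
by rewrite /square; split=> [[/=]|[h1 h2 h3 h4]]; [|split => /=]; rewrite !in_itv /=;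
  [move=> /andP[? ?] /andP[]|rewrite h1|rewrite h3].
Qed.

Lemma square_borel r : borel (square r).
Proof. exact: borel_box. Qed.

Lemma square_bnd r : bnd (square r).
Proof.
by exists r => p /squareP[h1 h2 h3 h4]; rewrite !ler_norml; split; apply/andP; split; exact: ltW.
Qed.

(** Four unbounded open convex sets around the square, arranged like a pinwheel:
    they are disjoint and their closures cover the complement of the square. *)
Definition pinwheel_dir (k : 'I_4) : plane R :=
  nth 0 [:: (0, -1); (-1, 0); (0, 1); (1, 0)] k.

Definition pinwheel (r : R) (k : 'I_4) : set (plane R) :=
  [set p | dot (pinwheel_dir k) p < - r] `&`
  [set p | dot (- perp (pinwheel_dir k)) p < r].

Lemma pinwheel_disjoint r i j : 0 < r -> i != j -> pinwheel r i `&` pinwheel r j = set0.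
Proof.
move=> r0 ij; rewrite -subset0 => -[x y] [[/= a b] [/= c d]].
case: i j ij a b c d => [[|[|[|[|//]]]] ?] [[|[|[|[|//]]]] ?] //= _;
  rewrite /dot /perp /=; lra.
Qed.

Lemma open_off_pinwheel r O : 0 < r -> open O -> (forall k, O `&` pinwheel r k = set0) ->
  O `<=` square r.
Proof.
move=> r0 /openP oO dO p Op; apply: contrapT => /squareP np.
have [e e0 He] := oO p Op.
have hit k (s t : R) : `|s| < e -> `|t| < e -> pinwheel r k (p.1 + s, p.2 + t) -> False.
  move=> se te kp; have : (O `&` pinwheel r k) (p.1 + s, p.2 + t).
    by split => //; apply: He; rewrite /= addrAC subrr add0r.
  by rewrite dO.
have e2 : `|e / 2| < e by rewrite gtr0_norm ?divr_gt0//; lra.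
have ne2 : `|- (e / 2)| < e by rewrite normrN.
have z0 : `|0 : R| < e by rewrite normr0.
have pin0 := hit (inord 0); have pin1 := hit (inord 1).
have pin2 := hit (inord 2); have pin3 := hit (inord 3).
move: pin0 pin1 pin2 pin3; rewrite /pinwheel /pinwheel_dir !inordK//= /dot /perp /=.
move=> pin0 pin1 pin2 pin3.
have [h1|h1] := leP r p.2.
  have [h2|h2] := ltP p.1 (- r).
    by apply: (pin3 0 0) => //=; split => /=; lra.
  by apply: (pin0 (e / 2) (e / 2)) => //=; split => /=; lra.
have [h2|h2] := leP r p.1.
  by apply: (pin1 (e / 2) (- (e / 2))) => //=; split => /=; lra.
have [h3|h3] := leP p.2 (- r).
  by apply: (pin2 (- (e / 2)) (- (e / 2))) => //=; split => /=; lra.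
have [h4|h4] := leP p.1 (- r).
  by apply: (pin3 (- (e / 2)) (e / 2)) => //=; split => /=; lra.
by apply: np.
Qed.

(** Contracting the closure of [O] towards a point of [O] by a ratio close to 1
    maps it into [O]. *)
Lemma area_hull_of O : open O -> bnd O -> O !=set0 -> closed (hull_of O) ->
  area (hull_of O) <= area O.
Proof.
move=> oO nO [q Oq] cP.
have bP := closed_borel cP; have bO := open_borel oO.
rewrite leNgt; apply/negP => lt.
have a0 : 0 < area (hull_of O) by apply: le_lt_trans lt; exact: area_ge0.
pose t := (area (hull_of O) - area O) / (4 * area (hull_of O)).
have t0 : 0 < t by rewrite divr_gt0 ?mulr_gt0 ?subr_gt0.
have t1 : t <= 4^-1.
  rewrite /t ler_pdivrMr ?mulr_gt0// mulKf//.
  by rewrite gerBl area_ge0.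
have t1' : 0 < 1 - t by lra.
have : area [set t *: q + (1 - t) *: p | p in hull_of O] <= area O.
  apply: le_area => //; first exact: borel_homothety.
  move=> _ [p Pp <-].
  have -> : t *: q + (1 - t) *: p = p + t *: (q - p).
    by apply/plane_eqP; rewrite !plane_coordE; split; ring.
  by apply: Pp => //; lra.
rewrite area_homothety//.
have : t * (4 * area (hull_of O)) = area (hull_of O) - area O.
  by rewrite /t divfK// gt_eqF// mulr_gt0.
by move: (area _) (area _) a0 lt => a b a0 lt; nra.
Qed.

(** The boundary of the square is handled by the four sets of the pinwheel: with
    the interiors of the bodies they form a packing of [K + 4] sets, whose maximal
    enlargement keeps the first [K] sets inside the square. *)
Theorem cluster_polygons (K : nat) (E : 'I_K -> set (plane R)) (r : R) : 0 < r ->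
  (forall i, convex_body (E i)) -> (forall i, E i `<=` square r) ->
  (forall i j, i != j -> (E i)° `&` (E j)° = set0) ->
  exists (P : 'I_K -> set (plane R)) (n : 'I_K -> nat),
  [/\ forall i, E i `<=` P i, forall i, (3 <= n i)%N,
      forall i, is_ngon (n i) (P i), (\sum_i n i <= 6 * (K + 4))%N &
      \sum_i area (P i) <= area (square r)].
Proof.
move=> r0 bodyE EQ dE.
pose B (k : 'I_K + 'I_4) := match k with inl i => (E i)° | inr j => pinwheel r j end.
have off i j : (E i)° `&` pinwheel r j = set0.
  rewrite -subset0 => p [/interior_subset/EQ/squareP[h1 h2 h3 h4]].
  by case: j => [[|[|[|[|//]]]] ?] [] /=; rewrite /dot /perp /=; lra.
have packB : convex_packing B.
  split.
  - move=> [i|j]; first exact: open_interior.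
    by apply: openI; exact: open_halfplane.
  - move=> [i|j]; first by apply: interior_convex; case: (bodyE i).
    by apply: convexI; exact: convex_halfplane.
  - move=> [i|j] [i'|j'] ij //=.
    + by apply: dE.
    + by rewrite setIC off.
    + by apply: pinwheel_disjoint.
have [ O [packO BO maxO]] := maximal_packing packB.
have B0 k : B k !=set0.
  case: k => [i|j]; first by case: (bodyE i).
  pose z : 'I_4 -> plane R := fun k => nth 0 [:: (0, r + r); (r + r, 0); (0, - (r + r)); (- (r + r), 0)] k.
  exists (z j); case: j => [[|[|[|[|//]]]] ?]; rewrite /z; split => /=;
    rewrite /dot /perp /=; lra.
have O0 k : O k !=set0 by have [p Bp] := B0 k; exists p; exact: BO.
have [oO cO disO] := packO.
have OQ i : O (inl i) `<=` square r.
  apply: open_off_pinwheel => // j; rewrite -subset0 => p [Op jp].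
  have : (O (inl i) `&` O (inr j)) p by split => //; exact: (BO (inr j)).
  by rewrite disO.
have nO i : bnd (O (inl i)) by apply: bndS (OQ i) (@square_bnd r).
have [n [nsum nP]] := maximal_packing_polygons packO O0 maxO.
have /choice[m mP] := fun i => nP (inl i) (nO i).
exists (fun i => hull_of (O (inl i))), m; split.
- move=> i p Ep; have [_ _ _ cP] := mP i.
  apply: contrapT => nPp; have [q Eq] := B0 (inl i).
  have [e e0 He] := open_ray (q - p) (closed_openC cP) nPp.
  pose t := Num.min e 1.
  have t0 : 0 < t by rewrite lt_min e0 ltr01.
  have te : t <= e by rewrite ge_min lexx.
  have t1 : t <= 1 by rewrite ge_min lexx orbT.
  have [cvE _ _] := bodyE i.
  have := He t; rewrite gtr0_norm// => /(_ te); apply.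
  have Oz : O (inl i) (p + t *: (q - p)).
    by apply: BO; exact: convex_interior.
  move=> w s Ow s0 s1.
  by have /convexP := cO (inl i); apply => //; exact: ltW.
- by move=> i; have [] := mP i.
- by move=> i; have [] := mP i.
- apply: (@leq_trans (\sum_i n i)); last by rewrite card_sum !card_ord in nsum.
  rewrite big_sumType/=; apply: leq_trans (leq_addr _ _).
  by apply: leq_sum => i _; have [] := mP i.
- apply: (@le_trans _ _ (\sum_i area (O (inl i)))).
    by apply: ler_sum => i _; apply: area_hull_of => //; have [] := mP i.
  apply: area_sum_le => //; first exact: square_borel.
  + exact: square_bnd.
  + by move=> i; exact: open_borel.
  + by move=> i j ij; apply: disO.
Qed.

End ClusterPolygons.

(** * The hexagonal bound for clusters in a square *)

Section ClusterBound.
Context {R : realType} (F : set (plane R) -> R) (alpha : R) (gamma : nat -> R).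
Hypothesis F_ge0 : forall K, convex_body K -> 0 <= F K.
Hypothesis H1 : forall K1 K2, convex_body K1 -> convex_body K2 ->
    K1 `<=` K2 -> F K2 <= F K1.
Hypothesis alpha_gt0 : 0 < alpha.
Hypothesis gammaE : forall n : nat, (3 <= n)%N ->
    is_min [set F P * area P `^ (alpha / 2) | P in [set P | is_ngon n P]]
           (gamma n).
Hypothesis H3ii : forall (k : nat) (n : 'I_k -> nat), (0 < k)%N ->
    (forall i, (3 <= n i)%N) ->
    k%:R^-1 * (\sum_(i < k) (n i)%:R) <= 6 :> R ->
    gamma 6%N `^ (2 / alpha) <=
      k%:R^-1 * \sum_(i < k) gamma (n i) `^ (2 / alpha).

Lemma gamma_ge0 n : (3 <= n)%N -> 0 <= gamma n.
Proof.
move=> /gammaE[[P [[bP _] _] <-] _].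
by rewrite mulr_ge0 ?powR_ge0// F_ge0.
Qed.

Lemma powR_half_inv (x : R) : 0 <= x -> (x `^ (alpha / 2)) `^ (2 / alpha) = x.
Proof.
move=> x0; rewrite -powRrM.
have -> : alpha / 2 * (2 / alpha) = 1 by field; rewrite gt_eqF.
by rewrite powRr1.
Qed.

(** The polygons of [cluster_polygons] have [6 * K + 24] sides in all, which is 24
    too many for the average to be at most 6; eight triangles, contributing three
    sides less than the average each, compensate for this at a bounded cost. *)
Theorem cluster_bound (K : nat) (E : 'I_K -> set (plane R)) (r m : R) : 0 < r ->
  (forall i, convex_body (E i)) -> (forall i, E i `<=` square r) ->
  (forall i j, i != j -> (E i)° `&` (E j)° = set0) ->
  0 <= m -> (forall i, F (E i) <= m) ->
  (K + 8)%:R * gamma 6%N `^ (2 / alpha) <=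
    m `^ (2 / alpha) * area (square r) + 8 * gamma 3%N `^ (2 / alpha).
Proof.
move=> r0 bodyE EQ dE m0 Fm.
have [P [n [EP n3 ngon sumn sumP]]] := cluster_polygons r0 bodyE EQ dE.
pose n' (i : 'I_(K + 8)) := match fintype.split i with inl a => n a | inr _ => 3%N end.
have n'l a : n' (lshift 8 a) = n a by rewrite /n' -[lshift 8 a]/(unsplit (inl a)) unsplitK.
have n'r a : n' (rshift K a) = 3%N by rewrite /n' -[rshift K a]/(unsplit (inr a)) unsplitK.
have K0 : (0 : R) < (K + 8)%:R by rewrite ltr0n addn_gt0 orbT.
have K80 : (0 < K + 8)%N by rewrite addn_gt0 orbT.
have := @H3ii (K + 8) n' K80.
have h3 i : (3 <= n' i)%N by rewrite /n'; case: (fintype.split i) => [a|_].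
have havg : (K + 8)%:R^-1 * (\sum_(i < K + 8) (n' i)%:R) <= 6 :> R.
  rewrite mulrC ler_pdivrMr// -natr_sum -natrM ler_nat big_split_ord/=.
  rewrite (eq_bigr n) => [|a _]; last by rewrite n'l.
  rewrite [X in (_ + X <= _)%N](eq_bigr (fun=> 3%N)) => [|a _]; last by rewrite n'r.
  rewrite sum_nat_const card_ord; apply: leq_trans (leq_add sumn (leqnn _)) _.
  lia.
move=> /(_ h3 havg); rewrite ler_pdivlMl// => /le_trans; apply.
rewrite big_split_ord/= lerD//.
  apply: (@le_trans _ _ (\sum_i m `^ (2 / alpha) * area (P i))).
    apply: ler_sum => a _; rewrite n'l.
    have [_ /(_ (F (P a) * area (P a) `^ (alpha / 2)))] := gammaE (n3 a).
    have ex : [set F P * area P `^ (alpha / 2) | P in [set P | is_ngon (n a) P]]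
        (F (P a) * area (P a) `^ (alpha / 2)) by exists (P a); first exact: ngon.
    move=> /(_ ex) le1.
    have bP : convex_body (P a) by have [[]] := ngon a.
    have FP : F (P a) <= m by apply: le_trans (Fm a); exact: H1.
    rewrite -[area (P a)]powR_half_inv ?area_ge0// -powRM ?powR_ge0//.
    apply: ge0_ler_powR; rewrite ?nnegrE ?divr_ge0 ?(ltW alpha_gt0)//.
    - exact: gamma_ge0.
    - by rewrite mulr_ge0 ?powR_ge0.
    - by apply: le_trans le1 _; rewrite ler_wpM2r ?powR_ge0.
  by rewrite -mulr_sumr ler_wpM2l ?powR_ge0.
rewrite (eq_bigr (fun=> gamma 3%N `^ (2 / alpha))) => [|a _]; last by rewrite n'r.
by rewrite sumr_const card_ord [8 * _]mulr_natl.
Qed.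

End ClusterBound.

(** * Translates of the regular hexagon tile the plane *)

Section Misc.
Context {R : realType}.
Implicit Types (A K : set (plane R)) (p v : plane R).

Lemma body_bnd K : convex_body K -> bnd K.
Proof. by move=> [_ cK _]; apply: bounded_bnd; exact: compact_bounded. Qed.

Lemma body_borel K : convex_body K -> borel K.
Proof.
by move=> [_ cK _]; apply: closed_borel; apply: compact_closed.
Qed.

Lemma convex_body_homothety v (t : R) K : 0 < t -> convex_body K ->
  convex_body [set v + t *: p | p in K].
Proof.
move=> t0 [/convexP cK compK [q Kq]]; split.
- apply/convexP => _ _ s [p1 Kp1 <-] [p2 Kp2 <-] s0 s1.
  exists (p1 + s *: (p2 - p1)); first exact: cK.
  by apply/plane_eqP; rewrite !plane_coordE; split; ring.
- apply: continuous_compact => //; apply: continuous_subspaceT => p.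
  exact: (cvgD (cvg_cst _) (@scaler_continuous _ _ t p)).
- exists (v + t *: q).
  have /openP/(_ _ Kq)[e e0 He] := @open_interior _ K.
  rewrite /interior; apply/nbhs_ballP; exists (t * e); first by rewrite /= mulr_gt0.
  move=> z [/= z1 z2]; exists (t^-1 *: (z - v)).
    apply: interior_subset; apply: He; rewrite !plane_coordE.
      have -> : t^-1 * (z.1 - v.1) - q.1 = t^-1 * (z.1 - (v.1 + t * q.1)).
        by field; rewrite gt_eqF.
      rewrite normrM gtr0_norm ?invr_gt0// -ltr_pdivlMl ?invr_gt0// invrK distrC.
      exact: z1.
    have -> : t^-1 * (z.2 - v.2) - q.2 = t^-1 * (z.2 - (v.2 + t * q.2)).
      by field; rewrite gt_eqF.
    rewrite normrM gtr0_norm ?invr_gt0// -ltr_pdivlMl ?invr_gt0// invrK distrC.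
    exact: z2.
  by rewrite scalerA mulfV ?gt_eqF// scale1r addrC subrK.
Qed.

Lemma translateE v K : translate v K = [set v + 1 *: p | p in K].
Proof.
apply/seteqP; split => _ [p Kp <-]; exists p => //; by rewrite scale1r.
Qed.

Lemma dilate_translateE (t : R) v K :
  dilate t (translate v K) = [set t *: v + t *: p | p in K].
Proof.
apply/seteqP; split => [_ [_ [p Kp <-] <-]|_ [p Kp <-]].
  by exists p => //; rewrite scalerDr.
by exists (v + p); [exists p|rewrite scalerDr].
Qed.

Lemma line_null A v (c : R) : borel A -> bnd A -> v != 0 ->
  (forall p, A p -> dot v p = c) -> area A = 0.
Proof.
move=> bA nA v0 Ac; apply: (translates_null (v := v)) => // p t t0 _ Ap /Ac.
rewrite dotDr dotZr (Ac p Ap) => /eqP; rewrite -subr_eq0 addrAC subrr add0r.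
by rewrite mulf_eq0 !gt_eqF// dot_gt0.
Qed.

(** [c := cos (pi / 3)] satisfies [4 c ^ 3 - 3 c = cos pi], that is
    [(c + 1) * (2 c - 1) ^ 2 = 0]. *)
Lemma cos_pi3 : cos (pi / 3) = 2^-1 :> R.
Proof.
set x : R := pi / 3; set c := cos x.
have pi0 := @pi_gt0 R.
have s0 : 0 < sin x by apply: sin_gt0_pihalf; rewrite /x; apply/andP; split; lra.
have c3 : (c + 1) * (2 * c - 1) ^+ 2 = 0.
  have : cos (x + x + x) = -1 by rewrite -cospi; congr cos; rewrite /x; lra.
  rewrite !cosD sinD -/c.
  have : sin x * sin x = 1 - c * c by rewrite -!expr2 sin2cos2.
  set s := sin x => ss h.
  have {h} : c * c * c - 3 * (s * s) * c = -1 by rewrite -h; ring.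
  by rewrite ss => h; rewrite expr2; lra.
have c1 : c + 1 != 0.
  apply/eqP => c1; have : sin x * sin x = 0.
    have cE : c = -1 by lra.
    by rewrite -!expr2 sin2cos2 -/c cE sqrrN expr1n subrr.
  by apply/eqP; rewrite mulf_neq0// gt_eqF.
move/eqP: c3; rewrite mulf_eq0 (negPf c1) /= sqrf_eq0 => /eqP h; lra.
Qed.

End Misc.

Section UnitCellCover.
Context {R : realType}.

(** In the coordinates of the two lattice vectors, the hexagons centred at the
    four vertices of the unit cell cover this cell. *)
Lemma unit_cell_cover (x y : R) : 0 <= x < 1 -> 0 <= y < 1 ->
  exists k l : bool, let x' := x - k%:R in let y' := y - l%:R in
    [/\ `|x' + 2 * y'| <= 1, `|x' - y'| <= 1 & `|2 * x' + y'| <= 1].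
Proof.
move=> /andP[x0 x1] /andP[y0 y1].
have [h1|h1] := leP (2 * x + y) 1; have [h2|h2] := leP (x + 2 * y) 1.
- by exists false, false; rewrite /= !ler_norml; split; apply/andP; split; lra.
- by exists false, true; rewrite /= !ler_norml; split; apply/andP; split; lra.
- by exists true, false; rewrite /= !ler_norml; split; apply/andP; split; lra.
have [h3|h3] := leP y x.
  have [h4|h4] := leP (x + 2 * y) 2.
    by exists true, false; rewrite /= !ler_norml; split; apply/andP; split; lra.
  by exists true, true; rewrite /= !ler_norml; split; apply/andP; split; lra.
have [h4|h4] := leP (2 * x + y) 2.
  by exists false, true; rewrite /= !ler_norml; split; apply/andP; split; lra.
by exists true, true; rewrite /= !ler_norml; split; apply/andP; split; lra.
Qed.

End UnitCellCover.

Section Hexagon.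
Context {R : realType} (c a b : plane R).
Hypothesis ab : det2 a b != 0.
Implicit Types (p : plane R).

(** Coordinate functionals of the basis [(a, b)]. *)
Let us : plane R := (det2 a b)^-1 *: (b.2, - b.1).
Let ut : plane R := (det2 a b)^-1 *: (- a.2, a.1).

Let usa : dot us a = 1.
Proof. by rewrite /us /dot !plane_coordE /=; move: ab; rewrite /det2 => h; field. Qed.
Let usb : dot us b = 0.
Proof. by rewrite /us /dot !plane_coordE /=; move: ab; rewrite /det2 => h; field. Qed.
Let uta : dot ut a = 0.
Proof. by rewrite /ut /dot !plane_coordE /=; move: ab; rewrite /det2 => h; field. Qed.
Let utb : dot ut b = 1.
Proof. by rewrite /ut /dot !plane_coordE /=; move: ab; rewrite /det2 => h; field. Qed.

Let coordE p : p = dot us p *: a + dot ut p *: b.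
Proof.
apply/plane_eqP; rewrite /us /ut /dot !plane_coordE /=; move: ab; rewrite /det2 => h.
by split; field.
Qed.

(** Every regular hexagon has this form, with [a] and [b] the vectors from the
    centre to two adjacent vertices; in the basis [(a, b)] all the arguments become
    linear arithmetic on integers. *)
Definition hexagon : set (plane R) :=
  [set p | exists s t : R, [/\ p = c + s *: a + t *: b, `|s| <= 1, `|t| <= 1 & `|s + t| <= 1]].

Let hexP p : hexagon p <-> [/\ `|dot us (p - c)| <= 1, `|dot ut (p - c)| <= 1 &
  `|dot us (p - c) + dot ut (p - c)| <= 1].
Proof.
split=> [[s [t [-> hs ht hst]]]|[h1 h2 h3]].
  have -> : c + s *: a + t *: b - c = s *: a + t *: b by apply/plane_eqP; rewrite !plane_coordE; split; ring.
  by rewrite !dotDr !dotZr usa usb uta utb !mulr0 !mulr1 addr0 add0r.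
exists (dot us (p - c)), (dot ut (p - c)); split => //.
by rewrite -addrA -coordE addrC subrK.
Qed.

Lemma convex_hexagon : convex hexagon.
Proof.
apply/convexP => p q t /hexP[p1 p2 p3] /hexP[q1 q2 q3] t0 t1; apply/hexP.
have -> : p + t *: (q - p) - c = (p - c) + t *: ((q - c) - (p - c)).
  by apply/plane_eqP; rewrite !plane_coordE; split; ring.
move: p1 p2 p3 q1 q2 q3; rewrite !(dotDr _ (_ - c)) !(dotZr _ t).
rewrite !(dotDr _ (_ - c) (- _)) !(dotNr _ (_ - c)).
set p1 := dot us (p - c); set p2 := dot ut (p - c).
set q1 := dot us (q - c); set q2 := dot ut (q - c).
rewrite !ler_norml => /andP[? ?] /andP[? ?] /andP[? ?] /andP[? ?] /andP[? ?] /andP[? ?].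
by split; apply/andP; split; nra.
Qed.

Let dir (k : 'I_6) : plane R :=
  nth 0 [:: us; - us; ut; - ut; us + ut; - (us + ut)] k.

Let dotDl u v p : dot (u + v) p = dot u p + dot v p.
Proof. by rewrite /dot !plane_coordE; ring. Qed.

Let hex_constraints : hexagon =
  closed_polyhedron (constraints dir (fun k => 1 + dot (dir k) c)).
Proof.
apply/seteqP; split=> [p /hexP|p Hp].
  rewrite !ler_norml => -[/andP[? ?] /andP[? ?] /andP[? ?]] _ [k _ <-] /=.
  rewrite -lerBlDr -dotNr -dotDr.
  by case: k => [[|[|[|[|[|[|//]]]]]] ?]; rewrite /dir /= ?dotNl ?dotDl; lra.
have H k : dot (dir k) (p - c) <= 1.
  by rewrite dotDr dotNr lerBlDr; apply: (Hp (_, _)); exists k.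
apply/hexP; rewrite !ler_norml.
have := H (inord 0); have := H (inord 1); have := H (inord 2).
have := H (inord 3); have := H (inord 4); have := H (inord 5).
rewrite /dir !inordK//= !dotNl !dotDl => ? ? ? ? ? ?.
by split; apply/andP; split; lra.
Qed.

Lemma hexagon_bnd : bnd hexagon.
Proof.
exists (`|c.1| + `|a.1| + `|b.1| + (`|c.2| + `|a.2| + `|b.2|)).
move=> _ [s [t [-> hs ht _]]].
have bound (x y z : R) : `|x + s * y + t * z| <= `|x| + `|y| + `|z|.
  apply: le_trans (ler_normD _ _) _; apply: lerD.
    by apply: le_trans (ler_normD _ _) _; rewrite lerD2l normrM ler_piMl.
  by rewrite normrM ler_piMl.
rewrite !plane_coordE; split; apply: le_trans (bound _ _ _) _.
  by rewrite lerDl !addr_ge0.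
by rewrite lerDr !addr_ge0.
Qed.

Lemma hexagon_body : convex_body hexagon.
Proof.
rewrite hex_constraints; apply: polygon_body.
  exists c => _ [k _ <-] /=; by rewrite ltrDr ltr01.
by rewrite -hex_constraints; exact: hexagon_bnd.
Qed.

Lemma hexagon_hull (V : set (plane R)) :
  V = [set c + a; c + b; c + (b - a); c - a; c - b; c + (a - b)] ->
  conv_hull V = hexagon.
Proof.
move=> VE; apply/seteqP; split.
  apply: smallest_sub; first exact: convex_hexagon.
  have hx (s t : R) : `|s| <= 1 -> `|t| <= 1 -> `|s + t| <= 1 ->
    hexagon (c + (s *: a + t *: b)) by move=> ? ? ?; exists s, t; split => //; rewrite addrA.
  have n0 : `|0 : R| <= 1 by rewrite normr0.
  have n1 : `|1 : R| <= 1 by rewrite normr1.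
  have nN1 : `|-1 : R| <= 1 by rewrite normrN1.
  rewrite VE => p [[[[[]|]|]|]|] ->.
  - by have := hx 1 0; rewrite scale1r scale0r !addr0; apply.
  - by have := hx 0 1; rewrite scale1r scale0r !add0r; apply.
  - by have := hx (-1) 1; rewrite scaleN1r scale1r addNr (addrC (- a)); apply.
  - by have := hx (-1) 0; rewrite scaleN1r scale0r !addr0; apply.
  - by have := hx 0 (-1); rewrite scaleN1r scale0r !add0r; apply.
  - by have := hx 1 (-1); rewrite scale1r scaleN1r subrr; apply.
move=> _ [s [t [-> hs ht hst]]] C [/convexP cC VC].
have C1 : C (c + a) by apply: VC; rewrite VE; do 5 left.
have C2 : C (c + b) by apply: VC; rewrite VE; do 4 left; right.
have C3 : C (c + (b - a)) by apply: VC; rewrite VE; do 3 left; right.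
have C4 : C (c - a) by apply: VC; rewrite VE; do 2 left; right.
have C5 : C (c - b) by apply: VC; rewrite VE; do 1 left; right.
have C6 : C (c + (a - b)) by apply: VC; rewrite VE; right.
have C0 : C c.
  have := cC _ _ 2^-1 C1 C4; rewrite invr_ge0 ler0n invf_le1// ler1n.
  move=> /(_ isT isT); by congr C; apply/plane_eqP; rewrite !plane_coordE; split; lra.
(* each of the six triangles around the centre is covered *)
have tri p q (x y : R) : C (c + p) -> C (c + q) -> 0 <= x -> 0 <= y -> x + y <= 1 ->
    C (c + (x *: p + y *: q)).
  move=> Cp Cq x0 y0 xy.
  have [xy0|xy0] := eqVneq (x + y) 0.
    have x00 : x = 0 by lra.
    have y00 : y = 0 by lra.
    by rewrite x00 y00 !scale0r !addr0; exact: C0.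
  have xyp : 0 < x + y by rewrite lt_def xy0 addr_ge0.
  have Cpq := cC _ _ (y / (x + y)) Cp Cq.
  have h0 : 0 <= y / (x + y) by rewrite divr_ge0 ?addr_ge0.
  have h1 : y / (x + y) <= 1 by rewrite ler_pdivrMr// mul1r lerDr.
  have := cC _ _ (x + y) C0 (Cpq h0 h1) (ltW xyp) xy.
  by congr C; apply/plane_eqP; rewrite !plane_coordE; split; field.
rewrite -addrA; move: hs ht hst; rewrite !ler_norml => /andP[s1 s2] /andP[t1 t2] /andP[st1 st2].
have [s0|s0] := leP 0 s; have [t0|t0] := leP 0 t.
- by apply: tri.
- have [st|st] := leP 0 (s + t).
    have -> : s *: a + t *: b = (s + t) *: a + (- t) *: (a - b).
      by apply/plane_eqP; rewrite !plane_coordE; split; ring.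
    by apply: tri => //; lra.
  have -> : s *: a + t *: b = s *: (a - b) + (- (s + t)) *: (- b).
    by apply/plane_eqP; rewrite !plane_coordE; split; ring.
  by apply: tri => //; lra.
- have [st|st] := leP 0 (s + t).
    have -> : s *: a + t *: b = (s + t) *: b + (- s) *: (b - a).
      by apply/plane_eqP; rewrite !plane_coordE; split; ring.
    by apply: tri => //; lra.
  have -> : s *: a + t *: b = t *: (b - a) + (- (s + t)) *: (- a).
    by apply/plane_eqP; rewrite !plane_coordE; split; ring.
  by apply: tri => //; lra.
- have -> : s *: a + t *: b = (- s) *: (- a) + (- t) *: (- b).
    by apply/plane_eqP; rewrite !plane_coordE; split; ring.
  by apply: tri => //; lra.
Qed.

(** The lattice spanned by [a + b] and [2 a - b], the vectors from a centre to the
    centres of two adjacent cells. *)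
Definition lattice (ij : int * int) : plane R :=
  (ij.1 + ij.2 * 2)%:~R *: a + (ij.1 - ij.2)%:~R *: b.

Let usl z : dot us (lattice z) = (z.1 + z.2 * 2)%:~R.
Proof. by rewrite /lattice dotDr !dotZr usa usb mulr1 mulr0 addr0. Qed.

Let utl z : dot ut (lattice z) = (z.1 - z.2)%:~R.
Proof. by rewrite /lattice dotDr !dotZr uta utb mulr1 mulr0 add0r. Qed.

Lemma hexagon_cover p : exists ij, hexagon (p - lattice ij).
Proof.
pose s := dot us (p - c); pose t := dot ut (p - c).
pose x := (s + t + t) / 3; pose y := (s - t) / 3.
pose i := Num.floor x; pose j := Num.floor y.
have /andP[i1 i2] : i%:~R <= x < (i + 1)%:~R by exact: real_floor_itv (num_real _).
have /andP[j1 j2] : j%:~R <= y < (j + 1)%:~R by exact: real_floor_itv (num_real _).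
have key k l : let x' := x - k%:~R in let y' := y - l%:~R in
    `|x' + 2 * y'| <= 1 -> `|x' - y'| <= 1 -> `|2 * x' + y'| <= 1 ->
    exists ij, hexagon (p - lattice ij).
  move=> x' y' h1 h2 h3; exists (k, l); apply/hexP.
  have -> : dot us (p - lattice (k, l) - c) = x' + 2 * y'.
    have -> : p - lattice (k, l) - c = (p - c) - lattice (k, l) by rewrite addrAC.
    rewrite dotDr dotNr usl -/s /= intrD intrM /x' /y' /x /y.
    by field.
  have -> : dot ut (p - lattice (k, l) - c) = x' - y'.
    have -> : p - lattice (k, l) - c = (p - c) - lattice (k, l) by rewrite addrAC.
    rewrite dotDr dotNr utl -/t /= intrB /x' /y' /x /y.
    by field.
  split => //; have -> // : x' + 2 * y' + (x' - y') = 2 * x' + y' by ring.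
rewrite intrD in i2; rewrite intrD in j2.
have [||k [l /= [h1 h2 h3]]] := @unit_cell_cover R (x - i%:~R) (y - j%:~R).
- by rewrite subr_ge0 i1 ltrBlDl.
- by rewrite subr_ge0 j1 ltrBlDl.
have ek : x - (i + (k : nat)%:Z)%:~R = x - i%:~R - k%:R.
  by rewrite intrD opprD addrA -pmulrn.
have el : y - (j + (l : nat)%:Z)%:~R = y - j%:~R - l%:R.
  by rewrite intrD opprD addrA -pmulrn.
by apply: (key (i + (k : nat)%:Z) (j + (l : nat)%:Z)); rewrite /= ek el.
Qed.

(** One of the coordinates [m], [n] or [m + n] of the difference of two distinct
    lattice points has absolute value at least 2, because [m] and [n] are congruent
    modulo 3; the hexagon has width 2 in each of these three coordinates. *)
Lemma lattice_separation ij kl : ij != kl ->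
  exists u (d : R), u != 0 /\
    forall p q, hexagon p -> hexagon q -> p + lattice ij = q + lattice kl ->
      dot u (p + lattice ij) = d.
Proof.
case: ij kl => i j [k l] ijkl.
have us0 : us != 0.
  by apply/eqP => u0; have := usa; rewrite u0 /dot /= !mul0r addr0 => /eqP; rewrite eq_sym oner_eq0.
have ut0 : ut != 0.
  by apply/eqP => u0; have := utb; rewrite u0 /dot /= !mul0r addr0 => /eqP; rewrite eq_sym oner_eq0.
have ust0 : us + ut != 0.
  apply/eqP => u0; have : dot (us + ut) a = 1 by rewrite dotDl usa uta addr0.
  by rewrite u0 /dot /= !mul0r addr0 => /eqP; rewrite eq_sym oner_eq0.
have main u (m : int) : u != 0 -> (forall p, hexagon p -> `|dot u (p - c)| <= 1) ->
    dot u (lattice (k, l)) - dot u (lattice (i, j)) = m%:~R -> (2 <= m) || (m <= -2) ->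
    exists u (d : R), u != 0 /\ forall p q, hexagon p -> hexagon q ->
      p + lattice (i, j) = q + lattice (k, l) -> dot u (p + lattice (i, j)) = d.
  move=> u0 hu um m2.
  exists u, ((if 0 < m then 1 else -1) + dot u c + dot u (lattice (i, j))); split => // p q hp hq pq.
  have : dot u p + dot u (lattice (i, j)) = dot u q + dot u (lattice (k, l)).
    by rewrite -!dotDr pq.
  have := hu _ hp; have := hu _ hq; rewrite !ler_norml !(dotDr _ _ (- c)) !dotNr => /andP[q1 q2] /andP[p1 p2].
  rewrite dotDr => e1; case/orP: m2 => m2.
    have -> : 0 < m by rewrite (lt_le_trans _ m2).
    have : (2 : int)%:~R <= m%:~R :> R by rewrite ler_int.
    by rewrite -um => h; have : (2 : int)%:~R = 2 :> R by []; lra.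
  have -> : (0 < m) = false by rewrite lt_gtF// (le_lt_trans m2).
  have : m%:~R <= (-2 : int)%:~R :> R by rewrite ler_int.
  by rewrite -um => h; have : (-2 : int)%:~R = - 2 :> R by []; lra.
pose x := k - i; pose y := l - j.
have xy : (x != 0) || (y != 0).
  by rewrite !subr_eq0 -negb_and; move: ijkl; rewrite xpair_eqE eq_sym [j == l]eq_sym.
have [hm|hm] := boolP ((2 <= x + y * 2) || (x + y * 2 <= -2)).
  apply: (main us _ us0 _ _ hm); first by move=> p /hexP[].
  by rewrite !usl -intrB /x /y /=; congr _%:~R; lia.
have [hn|hn] := boolP ((2 <= x - y) || (x - y <= -2)).
  apply: (main ut _ ut0 _ _ hn); first by move=> p /hexP[].
  by rewrite !utl -intrB /x /y /=; congr _%:~R; lia.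
have hmn : (2 <= x + y * 2 + (x - y)) || (x + y * 2 + (x - y) <= -2) by lia.
apply: (main (us + ut) _ ust0 _ _ hmn); first by move=> p /hexP[? ? ?]; rewrite dotDl.
by rewrite !dotDl !usl !utl -!intrD -intrB /x /y /=; congr _%:~R; lia.
Qed.

End Hexagon.

(** * Packing an open set by small hexagons *)

Section RegularHexagon.
Context {R : realType}.
Implicit Types (H U : set (plane R)).

(** Successive vertices satisfy [w (j + 2) = w (j + 1) - w j], since
    [cos (pi / 3) = 1 / 2]. *)
Lemma regular_hexagonE H : regular_hexagon H ->
  exists c a b : plane R, det2 a b != 0 /\ H = hexagon c a b.
Proof.
move=> [c [rho [theta [rho0 HE]]]].
set h : R := pi / 3.
pose a : plane R := rho *: (cos theta, sin theta).
pose b : plane R := rho *: (cos (theta + h), sin (theta + h)).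
have ch : cos h = 2^-1 by exact: cos_pi3.
have sh : 0 < sin h.
  have pi0 := @pi_gt0 R.
  by apply: sin_gt0_pihalf; rewrite /h; apply/andP; split; lra.
have dab : det2 a b = rho ^+ 2 * sin h.
  rewrite /det2 /a /b !plane_coordE /= cosD sinD.
  transitivity (rho ^+ 2 * (cos theta ^+ 2 + sin theta ^+ 2) * sin h); first by ring.
  by rewrite cos2Dsin2 mulr1.
have ab : det2 a b != 0 by rewrite dab mulf_neq0 ?sqrf_eq0 ?gt_eqF.
exists c, a, b; split => //; rewrite HE; apply: hexagon_hull => //.
pose w (j : nat) : plane R := rho *: (cos (theta + j%:R * h), sin (theta + j%:R * h)).
have w0 : w 0%N = a by rewrite /w mul0r addr0.
have w1 : w 1%N = b by rewrite /w mul1r.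
have wS j : w j.+2 = w j.+1 - w j.
  have cS x : cos (x + h) = cos x / 2 - sin x * sin h by rewrite cosD ch.
  have sS x : sin (x + h) = sin x / 2 + cos x * sin h by rewrite sinD ch.
  have eS : theta + j.+1%:R * h = theta + j%:R * h + h by rewrite -natr1; ring.
  have eSS : theta + j.+2%:R * h = theta + j%:R * h + h + h by rewrite -!natr1; ring.
  have ss : sin h * sin h = 3 / 4.
    by rewrite -expr2 sin2cos2 ch; lra.
  apply/plane_eqP; rewrite /w !plane_coordE eS eSS /= !(cS, sS).
  set x := cos _; set y := sin _; split.
    transitivity (rho * (x / 4 - y * sin h - x * (sin h * sin h))); first by field.
    by rewrite ss; field.
  transitivity (rho * (y / 4 + x * sin h - y * (sin h * sin h))); first by field.
  by rewrite ss; field.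
have w2 : w 2%N = b - a by rewrite wS w1 w0.
have w3 : w 3%N = - a by rewrite wS w2 w1 addrAC subrr add0r.
have w4 : w 4%N = - b by rewrite wS w3 w2 opprB addrA addNr add0r.
have w5 : w 5%N = a - b by rewrite wS w4 w3 opprK addrC.
apply/seteqP; split => [_ [j /= j6 <-]|].
  rewrite -/(w j).
  move: j j6 => [|[|[|[|[|[|//]]]]]] _; rewrite ?w0 ?w1 ?w2 ?w3 ?w4 ?w5.
  - by do 5 left.
  - by do 4 left; right.
  - by do 3 left; right.
  - by do 2 left; right.
  - by do 1 left; right.
  - by right.
move=> p [[[[[]|]|]|]|] ->.
- by exists 0%N => //; rewrite -/(w 0%N) w0.
- by exists 1%N => //; rewrite -/(w 1%N) w1.
- by exists 2%N => //; rewrite -/(w 2%N) w2.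
- by exists 3%N => //; rewrite -/(w 3%N) w3.
- by exists 4%N => //; rewrite -/(w 4%N) w4.
- by exists 5%N => //; rewrite -/(w 5%N) w5.
Qed.

(** The points at distance at least [e] from the complement of [U], for the sup
    norm. *)
Definition inset (e : R) U : set (plane R) :=
  [set p | forall q, `|q.1 - p.1| < e -> `|q.2 - p.2| < e -> U q].

Lemma inset_closed e U : closed (inset e U).
Proof.
rewrite -openC; apply/openP => p /existsNP[q]; rewrite !not_implyE => -[q1 [q2 nU]].
exists (Num.min (e - `|q.1 - p.1|) (e - `|q.2 - p.2|)).
  by rewrite lt_min !subr_gt0 q1.
move=> p'; rewrite !lt_min => /andP[a1 _] /andP[_ a2]; apply/existsNP; exists q.
rewrite !not_implyE; split; last split => //.
  have -> : q.1 - p'.1 = (q.1 - p.1) - (p'.1 - p.1) by ring.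
  by apply: le_lt_trans (ler_normB _ _) _; lra.
have -> : q.2 - p'.2 = (q.2 - p.2) - (p'.2 - p.2) by ring.
by apply: le_lt_trans (ler_normB _ _) _; lra.
Qed.

Lemma inset_area (eta : R) U : open U -> bnd U -> 0 < eta ->
  exists2 e : R, 0 < e & area U - eta < area (inset e U).
Proof.
move=> oU nU eta0.
pose F (n : nat) := inset n.+1%:R^-1 U.
have sub n : F n `<=` U by move=> p; apply; rewrite subrr normr0 invr_gt0.
have UF : \bigcup_n F n = U.
  apply/seteqP; split => [p [n _ /sub]//|p Up].
  have /openP/(_ p Up)[e e0 He] := oU.
  exists (Num.Def.archi_bound e^-1) => // q q1 q2.
  have lt : (Num.Def.archi_bound e^-1).+1%:R^-1 < e.
    rewrite invf_plt ?posrE//; apply: lt_trans (archi_boundP _) _; first by rewrite invr_ge0 ltW.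
    by rewrite ltr_nat.
  by apply: He; [exact: lt_trans lt|exact: lt_trans lt].
have bF n : borel (F n) by apply: closed_borel; exact: inset_closed.
have nF n : bnd (F n) by exact: bndS nU.
have bU : borel U by exact: open_borel.
have : leb2 (F n) @[n --> \oo] --> leb2 U.
  rewrite -[in X in _ --> X]UF; apply: nondecreasing_cvg_mu => //.
    by rewrite UF.
  move=> m n mn; apply/subsetPset => p Fp q q1 q2.
  have le : n.+1%:R^-1 <= m.+1%:R^-1 :> R by rewrite lef_pV2 ?posrE// ler_nat.
  by apply: Fp; [exact: lt_le_trans le|exact: lt_le_trans le].
rewrite leb2_area// => cvF.
have /fine_cvgP[_ cvA] := cvF.
have lt : area U - eta < area U by rewrite gtrBl.
have [n nP] := filter_ex (cvgr_gt _ cvA _ lt).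
by exists n.+1%:R^-1; rewrite ?invr_gt0.
Qed.

(** The small cells that meet an inset of [U] lie in [U] and cover the inset, so
    there are at least (area of the inset) / (area of a cell) of them.  That a
    cell of side ratio [delta] has area [delta ^ 2] uses only the normalisation
    of [H]. *)
Lemma hexagon_packing H U (eta : R) : regular_hexagon H -> area H = 1 ->
  open U -> bnd U -> 0 < eta ->
  exists2 delta0 : R, 0 < delta0 & forall (delta : R) (n : nat),
    0 < delta -> delta < delta0 -> n%:R * delta ^+ 2 <= area U - eta ->
    exists v : 'I_n -> plane R,
      (forall i, dilate delta (translate (v i) H) `<=` U) /\
      (forall i j, i != j -> leb2 (dilate delta (translate (v i) H) `&`
                                   dilate delta (translate (v j) H)) = 0%E).
Proof.
move=> /regular_hexagonE[c [a [b [ab HE]]]] H1 oU nU eta0.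
have bodyH : convex_body H by rewrite HE; exact: hexagon_body.
have [M HM] := body_bnd bodyH.
have borH := body_borel bodyH.
have [e e0 He] := inset_area oU nU eta0.
have M0 : 0 <= M.
  have [_ _ [q /interior_subset Hq]] := bodyH.
  by have [+ _] := HM q Hq; apply: le_trans.
have M1 : 0 < 2 * M + 1 by rewrite ltr_wpDl// mulr_ge0.
exists (e / (2 * M + 1)); first by rewrite divr_gt0.
move=> delta n d0 dlt nd.
have {dlt} dlt : delta * (2 * M + 1) < e by rewrite -ltr_pdivlMr.
pose cell (ij : int * int) := dilate delta (translate (lattice a b ij) H).
have cellE ij : cell ij = [set delta *: lattice a b ij + delta *: p | p in H].
  exact: dilate_translateE.
have bcell ij : borel (cell ij) by rewrite cellE; exact: borel_homothety.
have ncell ij : bnd (cell ij).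
  by rewrite cellE; apply: bnd_homothety; exact: body_bnd.
have acell ij : area (cell ij) = delta ^+ 2 by rewrite cellE area_homothety// H1 mulr1.
have null ij kl : ij != kl -> leb2 (cell ij `&` cell kl) = 0%E.
  move=> ijkl; have [u [d [u0 sep]]] := lattice_separation c ab ijkl.
  have bI := borelI (bcell ij) (bcell kl).
  have nI : bnd (cell ij `&` cell kl) by apply: bndS (ncell ij) => p [].
  rewrite leb2_area//; congr EFin; apply: (@line_null _ _ u (delta * d)) => // p.
  rewrite !cellE => -[[x Hx <-] [y Hy xy]].
  rewrite -scalerDr dotZr addrC (sep x y) -?HE//.
  move: xy; rewrite -!scalerDr => /(scalerI (lt0r_neq0 d0)).
  by rewrite addrC [RHS]addrC.
pose S := [set ij | cell ij `<=` U].
have cover p : inset e U p -> exists2 ij, S ij & cell ij p.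
  move=> Up; have [ij] := hexagon_cover c ab (delta^-1 *: p).
  rewrite -HE => Hq; exists ij; last first.
    rewrite cellE; exists (delta^-1 *: p - lattice a b ij) => //.
    by rewrite -scalerDr addrC subrK scalerA mulfV ?gt_eqF// scale1r.
  move=> z; rewrite cellE => -[x Hx <-]; apply: Up.
    have [x1 _] := HM x Hx; have [q1 _] := HM _ Hq.
    have -> : (delta *: lattice a b ij + delta *: x).1 - p.1 =
       delta * (x.1 - (delta^-1 *: p - lattice a b ij).1).
      by rewrite !plane_coordE; field; rewrite gt_eqF.
    rewrite normrM gtr0_norm//; apply: le_lt_trans dlt; rewrite ler_pM2l//.
    by apply: le_trans (ler_normB _ _) _; lra.
  have [_ x1] := HM x Hx; have [_ q1] := HM _ Hq.
  have -> : (delta *: lattice a b ij + delta *: x).2 - p.2 =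
     delta * (x.2 - (delta^-1 *: p - lattice a b ij).2).
    by rewrite !plane_coordE; field; rewrite gt_eqF.
  rewrite normrM gtr0_norm//; apply: le_lt_trans dlt; rewrite ler_pM2l//.
  by apply: le_trans (ler_normB _ _) _; lra.
(* as long as fewer than n cells are chosen, they cannot cover the inset *)
have grow m : (m <= n)%N -> exists s : seq (int * int),
    [/\ uniq s, forall ij, ij \in s -> S ij & size s = m].
  elim: m => [_|m IH mn]; first by exists [::].
  have [s [us sS sm]] := IH (ltnW mn).
  have [ij [Sij ijs]] : exists ij, S ij /\ ij \notin s.
    apply: contrapT => full.
    have : area (inset e U) <= \sum_(ij <- s) area (cell ij).
      apply: area_le_sum => //; first by apply: closed_borel; exact: inset_closed.
      move=> p /cover[ij Sij pij]; exists ij => //; apply/negPn/negP => ijs.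
      by apply: full; exists ij.
    rewrite (eq_bigr (fun=> delta ^+ 2)) => [|ij _]; last exact: acell.
    rewrite big_const_seq count_predT iter_addr_0 sm -mulr_natl => le1.
    have : m%:R * delta ^+ 2 <= n%:R * delta ^+ 2.
      by rewrite ler_pM2r ?exprn_gt0// ler_nat ltnW.
    by move: le1 He nd; lra.
  exists (ij :: s); split => /=; [by rewrite ijs| |by rewrite sm].
  by move=> kl; rewrite inE => /predU1P[->//|/sS].
have [s [us sS sn]] := grow n (leqnn n).
exists (fun i => lattice a b (nth (0, 0) s i)); split => [i|i j ij].
  by apply: sS; rewrite mem_nth// sn.
by apply: null; rewrite nth_uniq// sn.
Qed.

End RegularHexagon.

(** * Lipschitz boundaries have area zero *)

Section LipschitzBoundary.
Context {R : realType}.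


(** A square centred at [x] with sides parallel to [e] and [perp e]. *)
Let box (x : plane R) (d : R) (e : plane R) : set (plane R) :=
  [set p | `|dot e (p - x)| < d /\ `|dot (perp e) (p - x)| < d].

Let box_open x d e : open (box x d e).
Proof.
have strip u : open [set p : plane R | `|dot u (p - x)| < d].
  have := openI (@open_halfplane R u (d + dot u x))
    (@open_halfplane R (- u) (d - dot u x)).
  congr open; apply/seteqP; split=> p; rewrite /= ltr_norml dotDr dotNr dotNl.
    by move=> [h1 h2]; apply/andP; split; lra.
  by move=> /andP[h1 h2]; split; lra.
by have := openI (strip e) (strip (perp e)).
Qed.

Let boxx x d e : 0 < d -> box x d e x.
Proof. by move=> d0; rewrite /box /= subrr /dot /= !mulr0 addr0 normr0. Qed.

(** Near each of its points the boundary is contained in a graph over the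
    direction [e], which does not meet its translates along [perp e]; finitely many
    of these pieces cover the compact set [closure Omega `\` Omega]. *)
Lemma lipschitz_boundary_null (Omega : set (plane R)) : open Omega ->
  bnd Omega -> lipschitz_boundary Omega -> area (closure Omega `\` Omega) = 0.
Proof.
move=> oO nO lipO; set D := closure Omega `\` Omega.
have cD : closed D by apply: closedI; [exact: closed_closure|exact: open_closedC].
have bD := closed_borel cD.
have nD : bnd D by apply: bndS (closure_bnd nO) => p [].
have compD : compact D by exact: closed_bnd_compact.
have intO : Omega° = Omega.
  by apply/seteqP; split; [exact: interior_subset|move: oO; rewrite openE].
have local x : D x -> exists de : R * plane R,
    0 < de.1 /\ area (D `&` box x de.1 de.2) = 0.
  move=> Dx; have [|r [e [g [r0 ee lipg HO]]]] := lipO x.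
    by rewrite intO.
  exists (r, e); split => //=.
  have coordE (p : plane R) :
      p = x + dot e (p - x) *: e + dot (perp e) (p - x) *: perp e.
    move: ee; rewrite /dot /perp => ee; apply/plane_eqP; rewrite !plane_coordE /=; split.
      transitivity (x.1 + (e.1 * e.1 + e.2 * e.2) * (p.1 - x.1)); last by ring.
      by rewrite ee; ring.
    transitivity (x.2 + (e.1 * e.1 + e.2 * e.2) * (p.2 - x.2)); last by ring.
    by rewrite ee; ring.
  have OE p : box x r e p -> (Omega p <-> g (dot e (p - x)) < dot (perp e) (p - x)).
    by move=> [h1 h2]; have := HO _ _ h1 h2; rewrite -/(perp e) -coordE.
  have [k k0 lipk] : exists2 k : R, 0 <= k & forall s t, `|g s - g t| <= k * `|s - t|.
    have [k [_ Hk]] := lipg; exists (`|k| + 1); first by rewrite addr_ge0.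
    have kk : k < `|k| + 1 by rewrite (le_lt_trans (ler_norm k))// ltrDl.
    by move=> s t; have := Hk _ kk (s, t); apply.
  have graph p : D p -> box x r e p -> dot (perp e) (p - x) = g (dot e (p - x)).
    move=> [clp nOp] Vp; apply/eqP; rewrite eq_le; apply/andP; split.
      by rewrite leNgt; apply/negP => /(OE p Vp).
    rewrite leNgt; apply/negP => lt.
    set S := dot e (p - x) in lt; set T := dot (perp e) (p - x) in lt.
    have k1 : 0 < k + 1 by rewrite ltr_wpDl.
    pose d := (g S - T) / 2 / (k + 1).
    have d0 : 0 < d by rewrite !divr_gt0 ?subr_gt0.
    have dE : d * (k + 1) = (g S - T) / 2 by rewrite /d divfK// gt_eqF.
    have [q [Oq [Vq [q1 q2]]]] := clp (box x r e `&` box p d e)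
      (open_nbhs_nbhs (conj (openI (@box_open _ _ _) (@box_open _ _ _)) (conj Vp (boxx _ _ d0)))).
    move/(OE q Vq): Oq.
    have sq u : dot u (q - p) = dot u (q - x) - dot u (p - x).
      by rewrite !dotDr !dotNr; ring.
    rewrite sq -/S in q1; rewrite sq -/T in q2.
    have := lipk S (dot e (q - x)).
    have : k * `|S - dot e (q - x)| <= k * d by rewrite ler_wpM2l// distrC ltW.
    move: q2; rewrite ltr_norml => /andP[_ q2] h1 h2.
    have := le_trans (ler_norm _) h2.
    by lra.
  apply: (@translates_null _ _ (perp e)).
  - by apply: borelI => //; apply: open_borel; exact: box_open.
  - by apply: bndS nD => p [].
  - move=> p t t0 _ [Dp Vp] [Dq Vq].
    have := graph _ Dq Vq; have := graph _ Dp Vp.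
    have -> : dot (perp e) (p + t *: perp e - x) = dot (perp e) (p - x) + t.
      move: ee; rewrite /dot /perp !plane_coordE /= => ee.
      transitivity (- e.2 * (p.1 - x.1) + e.1 * (p.2 - x.2) + t * (e.1 * e.1 + e.2 * e.2)).
        by ring.
      by rewrite ee mulr1.
    have -> : dot e (p + t *: perp e - x) = dot e (p - x).
      by rewrite addrAC [LHS]dotDr dotZr dot_perp mulr0 addr0.
    by move=> -> /eqP; rewrite -subr_eq0 addrAC subrr add0r gt_eqF.
have /choice[f fP] : forall x, exists de : R * plane R, D x ->
    0 < de.1 /\ area (D `&` box x de.1 de.2) = 0.
  move=> x; have [/local[de H]|nDx] := pselect (D x); first by exists de.
  by exists (0, 0).
have [X DX] : exists X : seq (plane R), forall p, D p ->
    exists x : plane R, [/\ x \in X, D x & box x (f x).1 (f x).2 p].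
  (* the filter of the large finite sets of centres *)
  pose G : set_system (seq (plane R)) :=
    [set A | exists X0 : seq (plane R), forall X : seq (plane R), {subset X0 <= X} -> A X].
  have FG : Filter G.
    split.
    - by exists [::].
    - move=> A B [X0 AX] [X1 BX]; exists (X0 ++ X1) => X XX; split.
        by apply: AX => x xX; apply: XX; rewrite mem_cat xX.
      by apply: BX => x xX; apply: XX; rewrite mem_cat xX orbT.
    - by move=> A B AB [X0 AX]; exists X0 => X /AX/AB.
  pose covers (X : seq (plane R)) (p : plane R) :=
    exists x : plane R, [/\ x \in X, D x & box x (f x).1 (f x).2 p].
  have cov (x : plane R) : D x -> \forall p \near x & X \near G, covers X p.
    move=> Dx; exists (box x (f x).1 (f x).2, [set X : seq (plane R) | x \in X]) => /=.
      split; last by exists [:: x] => X; apply; rewrite inE.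
      apply: open_nbhs_nbhs; split; first exact: box_open.
      by apply: boxx; case: (fP x Dx).
    by move=> [p X] [/= Bp xX]; exists x.
  have [X0 HX0] := (compact_near_coveringP D).1 compD _ G covers FG cov.
  exists X0 => p Dp; exact: (HX0 X0).
apply/eqP; rewrite eq_le area_ge0 andbT.
apply: (@le_trans _ _ (\sum_(x <- [seq x <- X | x \in D]) area (D `&` box x (f x).1 (f x).2))).
  apply: area_le_sum => //.
  - by move=> x; apply: borelI => //; apply: open_borel; exact: box_open.
  - by move=> x; apply: bndS nD => p [].
  - move=> p Dp; have [x [xX Dx Bp]] := DX p Dp; exists x => //.
    by rewrite mem_filter xX andbT; exact/mem_set.
rewrite big_seq big1// => x; rewrite mem_filter => /andP[/set_mem/fP[]] //.
Qed.

End LipschitzBoundary.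

(** * The limit *)

Section Interiors.
Context {R : realType}.
Implicit Types (K L : set (plane R)).

Lemma null_interior_disjoint K L : convex_body K -> convex_body L ->
  leb2 (K `&` L) = 0%E -> K° `&` L° = set0.
Proof.
move=> bK bL null; apply/eqP/negPn/negP => /set0P KL.
have oKL : open (K° `&` L°) by apply: openI; exact: open_interior.
have := open_leb2_gt0 oKL KL; rewrite ltNge => /negP; apply; rewrite -null.
apply: le_measure; rewrite ?inE.
- exact: open_borel.
- by apply: borelI; exact: body_borel.
- by apply: setISS; exact: interior_subset.
Qed.

Lemma square_open (r : R) : open (square r).
Proof.
have := openI (openI (@open_halfplane R (1, 0) r) (@open_halfplane R (-1, 0) r))
    (openI (@open_halfplane R (0, 1) r) (@open_halfplane R (0, -1) r)).
congr open; apply/seteqP; split => [p [[/=]]|p /squareP[h1 h2 h3 h4]].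
  rewrite /dot /= => h1 h2 [/=]; rewrite /dot /= => h3 h4.
  by apply/squareP; split; lra.
by split; split; rewrite /= /dot /=; lra.
Qed.

End Interiors.

Section Limit.
Context {R : realType} (Omega : set (plane R)).
Hypotheses (Omega_neq0 : Omega !=set0) (Omega_open : open Omega)
  (Omega_bnd : bnd Omega) (Omega_lip : lipschitz_boundary Omega).
Context (F : set (plane R) -> R) (alpha : R) (gamma : nat -> R) (H : set (plane R)).
Hypothesis F_ge0 : forall K, convex_body K -> 0 <= F K.
Hypothesis H1 : forall K1 K2, convex_body K1 -> convex_body K2 ->
    K1 `<=` K2 -> F K2 <= F K1.
Hypothesis alpha_gt0 : 0 < alpha.
Hypothesis H2 : forall (t : R) K, 0 < t -> convex_body K ->
    F (dilate t K) = t `^ (- alpha) * F K.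
Hypothesis gammaE : forall n : nat, (3 <= n)%N ->
    is_min [set F P * area P `^ (alpha / 2) | P in [set P | is_ngon n P]]
           (gamma n).
Hypotheses (H_hex : regular_hexagon H) (H_area : area H = 1)
  (H3i : forall v : plane R, gamma 6%N = F (translate v H)).
Hypothesis H3ii : forall (k : nat) (n : 'I_k -> nat), (0 < k)%N ->
    (forall i, (3 <= n i)%N) ->
    k%:R^-1 * (\sum_(i < k) (n i)%:R) <= 6 :> R ->
    gamma 6%N `^ (2 / alpha) <=
      k%:R^-1 * \sum_(i < k) gamma (n i) `^ (2 / alpha).

Let g := gamma 6%N `^ (2 / alpha).
Let A := area Omega.
Let M k := M_inf F Omega k `^ (2 / alpha).

Let a2 : 0 < 2 / alpha. Proof. by rewrite divr_gt0. Qed.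
Let g_ge0 : 0 <= g. Proof. exact: powR_ge0. Qed.
Let A_gt0 : 0 < A. Proof. exact: open_area_gt0. Qed.
Let gamma6_ge0 : 0 <= gamma 6%N. Proof. exact: gamma_ge0 F_ge0 gammaE _ _. Qed.

Let H_body : convex_body H.
Proof. by have [c [a [b [ab ->]]]] := regular_hexagonE H_hex; exact: hexagon_body. Qed.

Let cell_body (d : R) v : 0 < d -> convex_body (dilate d (translate v H)).
Proof. by move=> d0; rewrite dilate_translateE; exact: convex_body_homothety. Qed.

Let F_cell (d : R) v : 0 < d ->
  F (dilate d (translate v H)) = d `^ (- alpha) * gamma 6%N.
Proof.
move=> d0; rewrite H2 -?H3i// translateE; exact: convex_body_homothety.
Qed.

Let F_cell_pow (d : R) : 0 < d ->
  (d `^ (- alpha) * gamma 6%N) `^ (2 / alpha) = g / d ^+ 2.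
Proof.
move=> d0; rewrite powRM ?powR_ge0// -powRrM mulrC; congr (_ * _).
have -> : - alpha * (2 / alpha) = - 2 by field; rewrite gt_eqF.
by rewrite powR_invn// ltW.
Qed.

Let le_pow (x y : R) : 0 <= x -> x <= y -> x `^ (2 / alpha) <= y `^ (2 / alpha).
Proof.
move=> x0 xy; apply: ge0_ler_powR => //; rewrite ?nnegrE ?(ltW a2)//.
exact: le_trans xy.
Qed.

Let pow_le (x y : R) : 0 <= x -> 0 <= y -> x `^ (2 / alpha) <= y `^ (2 / alpha) -> x <= y.
Proof.
move=> x0 y0; apply: contraTT; rewrite -!ltNge => yx.
by apply: gt0_ltr_powR.
Qed.

Let maxF k (E : 'I_k -> set (plane R)) := \big[Num.max/0]_(i < k) F (E i).

Let maxF_ge0 k E : 0 <= @maxF k E.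
Proof. exact: bigmax_ge_id. Qed.

Let values k := [set \big[Num.max/0]_(i < k) F (E i)
      | E in [set E : 'I_k -> set (plane R) | convex_cluster Omega E]].

Let values_lb k : lbound (values k) 0.
Proof. by move=> _ [E _ <-]; exact: maxF_ge0. Qed.

Let M_inf_ge0 k : 0 <= M_inf F Omega k.
Proof.
have [v0|v0] := pselect (values k !=set0); first exact: lb_le_inf (@values_lb k).
rewrite /M_inf (_ : [set _ | _ in _] = set0) ?inf0//.
by apply/seteqP; split => // x vx; apply: v0; exists x.
Qed.

(** Upper bound: [k] hexagons of area [(A - eta) / k] fit into [Omega]. *)
Let hexagon_cluster (eta : R) : 0 < eta -> eta < A ->
  exists N, forall k, (N <= k)%N -> (0 < k)%N ->
    values k !=set0 /\ M k <= g * k%:R / (A - eta).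
Proof.
move=> eta0 etaA.
have [d0 d00 Hd] := hexagon_packing H_hex H_area Omega_open Omega_bnd eta0.
have Ae : 0 < A - eta by rewrite subr_gt0.
pose N := (Num.truncn ((A - eta) / d0 ^+ 2)).+1.
exists N => k Nk k0.
have kR : (0 : R) < k%:R by rewrite ltr0n.
pose d := Num.sqrt ((A - eta) / k%:R).
have d_gt0 : 0 < d by rewrite sqrtr_gt0 divr_gt0.
have d2 : d ^+ 2 = (A - eta) / k%:R by rewrite sqr_sqrtr// divr_ge0// ltW.
have dd0 : d < d0.
  rewrite -(ltr_pXn2r (n := 2)) ?nnegrE ?(ltW d_gt0) ?(ltW d00)// d2.
  rewrite ltr_pdivrMr// mulrC -ltr_pdivrMr ?exprn_gt0//.
  by apply: lt_le_trans (truncnS_gt _) _; rewrite ler_nat.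
have [|v [vO vnull]] := Hd d k d_gt0 dd0.
  by rewrite d2 mulrCA mulfV ?gt_eqF// mulr1.
pose E (i : 'I_k) := dilate d (translate (v i) H).
have clE : convex_cluster Omega E by split => // i; exact: cell_body.
have vE : values k (maxF E) by exists E.
split; first by exists (maxF E).
have le1 : M_inf F Omega k <= d `^ (- alpha) * gamma 6%N.
  apply: (@le_trans _ _ (maxF E)).
    by apply: ge_inf => //; exists 0; exact: values_lb.
  apply: bigmax_le; first by rewrite mulr_ge0 ?powR_ge0.
  by move=> i _; rewrite F_cell.
apply: le_trans (le_pow (M_inf_ge0 k) le1) _.
by rewrite F_cell_pow// d2 invf_div mulrA.
Qed.

(** Lower bound.  [Omega] need not be convex, so the bound for clusters is applied
    in a square [Q] containing [Omega], after filling the rest of [Q] with hexagons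
    of the size [d] for which [F] takes the value [m] of the cluster.  Their number
    is about [(area Q - A) / d ^ 2], with [g / d ^ 2 = m'], which turns the bound
    [m' * area Q] into [m' * A].  Hexagons of this size pack well because [m'] tends
    to infinity with [k], by the bound for the cluster alone. *)
Let cluster_lower (eta : R) : 0 < g -> 0 < eta ->
  exists (C : R) N, 0 <= C /\ forall k (E : 'I_k -> set (plane R)), (N <= k)%N ->
    convex_cluster Omega E ->
    k%:R * g <= maxF E `^ (2 / alpha) * (A + eta) + C.
Proof.
move=> g0 eta0.
have [B OB] := Omega_bnd.
pose r := `|B| + 1.
have r0 : 0 < r by rewrite ltr_wpDl.
have Or : Omega `<=` square r.
  move=> p /OB[]; rewrite !ler_norml => /andP[? ?] /andP[? ?].
  by apply/squareP; have := ler_norm B; rewrite /r; split; lra.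
pose Q := square r.
have bQ : borel Q by exact: square_borel.
have nQ : bnd Q by exact: square_bnd.
have oQ : open Q by exact: square_open.
pose U := Q `\` closure Omega.
have oU : open U by apply: openI => //; exact: closed_openC (@closed_closure _ _).
have nU : bnd U by apply: bndS nQ => p [].
have bU := open_borel oU.
have bO := open_borel Omega_open.
have nclO := closure_bnd Omega_bnd.
have bclO : borel (closure Omega) by apply: closed_borel; exact: closed_closure.
have areaU : area Q <= area U + A.
  have cover : Q `<=` U `|` (Omega `|` (closure Omega `\` Omega)).
    move=> p Qp; have [cp|ncp] := pselect (closure Omega p); last by left.
    by right; have [Op|nOp] := pselect (Omega p); [left|right].
  have bD : borel (closure Omega `\` Omega) by exact: borelD.
  have nD : bnd (closure Omega `\` Omega) by apply: bndS nclO => p [].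
  apply: (@le_trans _ _ (area (U `|` (Omega `|` (closure Omega `\` Omega))))).
    apply: le_area => //; last by do 2 (apply: bndU => //).
    by do 2 (apply: borelU => //).
  apply: le_trans (area_subU bU (borelU bO bD) nU (bndU Omega_bnd nD)) _.
  rewrite lerD2l; apply: le_trans (area_subU bO bD Omega_bnd nD) _.
  by rewrite lipschitz_boundary_null// addr0.
have [d0 d00 Hd] := hexagon_packing H_hex H_area oU nU eta0.
have g3_ge0 : 0 <= gamma 3%N `^ (2 / alpha) by exact: powR_ge0.
pose C := 8 * gamma 3%N `^ (2 / alpha) + g.
exists C, (Num.truncn ((area Q * (g / d0 ^+ 2) + C) / g)).+1.
split; first by rewrite addr_ge0// mulr_ge0.
move=> k E Nk [bodyE EO nullE].
set m := maxF E; have m0 : 0 <= m by exact: maxF_ge0.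
have Fm i : F (E i) <= m by exact: le_bigmax.
have dE i j : i != j -> (E i)° `&` (E j)° = set0.
  by move=> ij; apply: null_interior_disjoint => //; exact: nullE.
have EQ i : E i `<=` Q by move=> p /EO/Or.
have bound0 := cluster_bound F_ge0 H1 alpha_gt0 gammaE H3ii r0 bodyE EQ dE m0 Fm.
rewrite -/g in bound0.
have Q0 : 0 < area Q.
  by apply: open_area_gt0 => //; case: Omega_neq0 => p /Or; exists p.
set m' := m `^ (2 / alpha) in bound0 *.
have kg : area Q * (g / d0 ^+ 2) + C < k%:R * g.
  rewrite -ltr_pdivrMr//; apply: lt_le_trans (truncnS_gt _) _.
  by rewrite ler_nat.
have m'lt : g / d0 ^+ 2 < m'.
  rewrite -(ltr_pM2l Q0).
  move: bound0 kg; rewrite natrD mulrDl /C -/Q.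
  by move: (g / d0 ^+ 2) (gamma 3%N `^ _) => z g3; lra.
have m'0 : 0 < m' by apply: lt_trans m'lt; rewrite divr_gt0 ?exprn_gt0.
(* if U has almost no room for hexagons, the area of Q is close to A already *)
have [Ueta|Ueta] := ltP (area U) eta.
  have h : m' * area Q <= m' * (A + eta) by rewrite ler_wpM2l ?(ltW m'0)//; lra.
  by move: bound0; rewrite natrD mulrDl /C -/Q; lra.
pose d := Num.sqrt (g / m').
have d_gt0 : 0 < d by rewrite sqrtr_gt0 divr_gt0.
have d2 : d ^+ 2 = g / m' by rewrite sqr_sqrtr// divr_ge0// ltW.
have dd0 : d < d0.
  rewrite -(ltr_pXn2r (n := 2)) ?nnegrE ?(ltW d_gt0) ?(ltW d00)// d2.
  by rewrite ltr_pdivrMr// mulrC -ltr_pdivrMr ?exprn_gt0.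
pose n := Num.truncn ((area U - eta) / d ^+ 2).
have Ueta0 : 0 <= area U - eta by rewrite subr_ge0.
have /andP[n1 n2] := truncn_itv (divr_ge0 Ueta0 (sqr_ge0 d)).
rewrite -/n in n1 n2.
have d20 : 0 < d ^+ 2 by rewrite exprn_gt0.
rewrite ler_pdivlMr// in n1; rewrite ltr_pdivrMr// in n2.
have [v [vU vnull]] := Hd d n d_gt0 dd0 n1.
pose E' (i : 'I_(k + n)) := match fintype.split i with
  inl a => E a | inr b => dilate d (translate (v b) H) end.
have bodyE' i : convex_body (E' i).
  by rewrite /E'; case: (fintype.split i) => [a|b]; [exact: bodyE|exact: cell_body].
have E'Q i : E' i `<=` Q.
  by rewrite /E'; case: (fintype.split i) => [a|b]; [exact: EQ|move=> p /vU[]].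
have off a b : (E a)° `&` (dilate d (translate (v b) H))° = set0.
  rewrite -subset0 => p [/interior_subset/EO Op /interior_subset/vU[_]]; apply.
  exact: subset_closure.
have dE' i j : i != j -> (E' i)° `&` (E' j)° = set0.
  rewrite /E' -(inj_eq (can_inj (@splitK k n))).
  case: (fintype.split i) => [a|b]; case: (fintype.split j) => [a'|b'] ij.
  - by apply: dE; apply: contraNneq ij => ->.
  - exact: off.
  - by rewrite setIC; exact: off.
  - apply: null_interior_disjoint; [exact: cell_body|exact: cell_body|].
    by apply: vnull; apply: contraNneq ij => ->.
have Fm' i : F (E' i) <= m.
  rewrite /E'; case: (fintype.split i) => [a|b] //; rewrite F_cell//.
  apply: pow_le => //; first by rewrite mulr_ge0 ?powR_ge0.
  by rewrite F_cell_pow// d2 -/m' invf_div mulrCA mulfV ?mulr1// gt_eqF.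
have := cluster_bound F_ge0 H1 alpha_gt0 gammaE H3ii r0 bodyE' E'Q dE' m0 Fm'.
rewrite -/g -/m' -/Q natrD natrD.
have {n2} n2 : (area U - eta) * m' < (n%:R + 1) * g.
  move: n2; rewrite d2 mulrA ltr_pdivlMr// natr1; exact.
have h : m' * area Q <= m' * (area U + A) by rewrite ler_wpM2l// ltW.
move: n2 h; rewrite /C; move: (area U) (area Q) (n%:R) => u q N.
by move: (gamma 3%N `^ _) => g3; lra.
Qed.

Let t_upper (e : R) : 0 < e -> exists N, forall k, (N <= k)%N -> (0 < k)%N ->
  values k !=set0 /\ A * M k < (g + e) * k%:R.
Proof.
move=> e0; pose eta := e * A / (2 * (g + e)).
have ge : 0 < g + e by rewrite ltr_wpDl.
have eta0 : 0 < eta by rewrite divr_gt0 ?mulr_gt0.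
have etaE : eta * (g + e) = e * A / 2 by rewrite /eta; field; rewrite gt_eqF.
have etaA : eta < A.
  rewrite ltNge; apply/negP => Aeta.
  have : A * e <= eta * e by rewrite ler_pM2r.
  have : 0 <= eta * g by rewrite mulr_ge0// ltW.
  have : 0 < e * A by rewrite mulr_gt0.
  by lra.
have [N HN] := hexagon_cluster eta0 etaA.
exists N => k Nk k0; have [v0 Mk] := HN k Nk k0; split => //.
have kR : (0 : R) < k%:R by rewrite ltr0n.
have Ae : 0 < A - eta by rewrite subr_gt0.
rewrite ler_pdivlMr// in Mk.
rewrite -(ltr_pM2r Ae).
have : A * (M k * (A - eta)) <= A * (g * k%:R) by rewrite ler_pM2l.
have : A * g < (g + e) * (A - eta) by nra.
move=> h1 h2; have : A * g * k%:R < (g + e) * (A - eta) * k%:R by rewrite ltr_pM2r.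
by move: h2; lra.
Qed.

Let t_lower (e : R) : 0 < e -> exists N, forall k, (N <= k)%N -> (0 < k)%N ->
  (g - e) * k%:R < A * M k.
Proof.
move=> e0; have [g0|g0] := leP g 0.
  exists 0%N => k _ k0; have kR : (0 : R) < k%:R by rewrite ltr0n.
  have : 0 <= A * M k by rewrite mulr_ge0 ?powR_ge0// ltW.
  by nra.
pose eta := e * A / (2 * (g + e)).
have ge : 0 < g + e by rewrite ltr_wpDl.
have eta0 : 0 < eta by rewrite divr_gt0 ?mulr_gt0.
have etaE : eta * (g + e) = e * A / 2 by rewrite /eta; field; rewrite gt_eqF.
have [C [N1 [C0 HC]]] := cluster_lower g0 eta0.
have [N2 HN2] := t_upper e0.
exists (maxn (maxn N1 N2) (maxn (Num.truncn (C / g)).+1 (Num.truncn (2 * C / e)).+1)) => k.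
rewrite !geq_max => /andP[/andP[kN1 kN2] /andP[k1 k2]] k0.
have [v0 _] := HN2 k kN2 k0.
have kC : C < k%:R * g.
  by rewrite -ltr_pdivrMr//; apply: lt_le_trans (truncnS_gt _) _; rewrite ler_nat.
have kCe : 2 * C < k%:R * e.
  by rewrite -ltr_pdivrMr//; apply: lt_le_trans (truncnS_gt _) _; rewrite ler_nat.
have Ae : 0 < A + eta by rewrite addr_gt0.
pose x := (k%:R * g - C) / (A + eta).
have x0 : 0 <= x by rewrite divr_ge0 ?(ltW Ae)// subr_ge0 ltW.
have xM : x <= M k.
  rewrite -[x](powR_half_inv alpha_gt0)//; apply: le_pow; first exact: powR_ge0.
  apply: lb_le_inf => // _ [E clE <-]; rewrite -/(maxF E).
  apply: pow_le; rewrite ?powR_ge0 ?maxF_ge0// powR_half_inv//.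
  by rewrite /x ler_pdivrMr// lerBlDr; exact: HC.
have : x * (A + eta) = k%:R * g - C by rewrite /x divfK// gt_eqF.
have : A * x <= A * M k by rewrite ler_pM2l.
rewrite -(ltr_pM2r Ae) => h1 h2.
have : A * x * (A + eta) <= A * M k * (A + eta) by rewrite ler_pM2r.
have -> : A * x * (A + eta) = A * (k%:R * g - C) by rewrite -mulrA h2.
apply: lt_le_trans.
have kR : (0 : R) < k%:R by rewrite ltr0n.
have h3 : (g - e) * (A + eta) <= g * A - e * A / 2.
  have : 0 < eta * e by rewrite mulr_gt0.
  by nra.
have h4 : (g - e) * (A + eta) * k%:R <= (g * A - e * A / 2) * k%:R by rewrite ler_pM2r.
have h5 : A * (2 * C) < A * (k%:R * e) by rewrite ltr_pM2l.
by lra.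
Qed.

Theorem rescaled_limit :
  (fun k : nat => A `^ (alpha / 2) / k%:R `^ (alpha / 2) * M_inf F Omega k)
    @ \oo --> gamma 6%N.
Proof.
have ah : 0 < alpha / 2 by rewrite divr_gt0.
pose s k := A `^ (alpha / 2) / k%:R `^ (alpha / 2) * M_inf F Omega k.
have s_ge0 k : 0 <= s k by rewrite mulr_ge0// divr_ge0 ?powR_ge0.
have sE k : (0 < k)%N -> s k `^ (2 / alpha) = A * M k / k%:R.
  move=> k0; rewrite /s powRM ?divr_ge0 ?powR_ge0//.
  rewrite powRM ?powR_ge0// ?invr_ge0 ?powR_ge0//.
  rewrite (powR_half_inv alpha_gt0) ?(ltW A_gt0)// -powRN -powRrM.
  have -> : - (alpha / 2) * (2 / alpha) = -1 by field; rewrite gt_eqF.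
  by rewrite powR_inv1// mulrAC.
apply/cvgrPdist_lt => e e0.
have up : g < (gamma 6%N + e) `^ (2 / alpha).
  apply: gt0_ltr_powR => //; rewrite ?nnegrE ?addr_ge0 ?(ltW e0)//.
  by rewrite ltrDl.
have up0 : 0 < (gamma 6%N + e) `^ (2 / alpha) - g by rewrite subr_gt0.
have [N1 HN1] := t_upper up0.
have [N2 HN2] : exists N, forall k, (N <= k)%N -> (0 < k)%N -> gamma 6%N - e < s k.
  have [ge|ge] := ltP (gamma 6%N) e.
    by exists 0%N => k _ _; apply: lt_le_trans (s_ge0 k); rewrite subr_lt0.
  have lo : (gamma 6%N - e) `^ (2 / alpha) < g.
    apply: gt0_ltr_powR => //; rewrite ?nnegrE ?subr_ge0//.
    by rewrite gtrBl.
  have lo0 : 0 < g - (gamma 6%N - e) `^ (2 / alpha) by rewrite subr_gt0.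
  have [N HN] := t_lower lo0; exists N => k Nk k0.
  have := HN k Nk k0; rewrite subKr -ltr_pdivlMr ?ltr0n// -sE// => h.
  by rewrite ltNge; apply/negP => /(le_pow (s_ge0 k)); rewrite leNgt h.
near=> k.
have k0 : (0 < k)%N by near: k; exists 1%N.
have k1 : (N1 <= k)%N by near: k; exists N1.
have k2 : (N2 <= k)%N by near: k; exists N2.
rewrite distrC ltr_distl; apply/andP; split; first exact: HN2.
have [_] := HN1 k k1 k0; rewrite addrC subrK -ltr_pdivrMr ?ltr0n// -sE// => h.
rewrite ltNge; apply/negP => h'.
have := le_pow _ h'; rewrite addr_ge0 ?(ltW e0)// => /(_ isT).
by rewrite leNgt h.
Unshelve. all: by end_near.
Qed.

End Limit.

Theorem theorem3 (R : realType) (Omega : set (plane R))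
  (Omega_neq0 : Omega !=set0) (Omega_open : open Omega)
  (Omega_bounded : bounded_set Omega) (Omega_lip : lipschitz_boundary Omega)
  (F : set (plane R) -> R) (F_ge0 : forall K, convex_body K -> 0 <= F K)
  (H1 : forall K1 K2, convex_body K1 -> convex_body K2 ->
    K1 `<=` K2 -> F K2 <= F K1)
  (alpha : R) (alpha_gt0 : 0 < alpha)
  (H2 : forall (t : R) K, 0 < t -> convex_body K ->
    F (dilate t K) = t `^ (- alpha) * F K)
  (gamma : nat -> R)
  (gammaE : forall n : nat, (3 <= n)%N ->
    is_min [set F P * area P `^ (alpha / 2) | P in [set P | is_ngon n P]]
           (gamma n))
  (H : set (plane R)) (H_hex : regular_hexagon H) (H_area : area H = 1)
  (H3i : forall v : plane R, gamma 6%N = F (translate v H))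
  (H3ii : forall (k : nat) (n : 'I_k -> nat), (0 < k)%N ->
    (forall i, (3 <= n i)%N) ->
    k%:R^-1 * (\sum_(i < k) (n i)%:R) <= 6 :> R ->
    gamma 6%N `^ (2 / alpha) <=
      k%:R^-1 * \sum_(i < k) gamma (n i) `^ (2 / alpha)) :
  (fun k : nat =>
     area Omega `^ (alpha / 2) / k%:R `^ (alpha / 2) * M_inf F Omega k)
    @ \oo --> F H.
Proof.
have HE : gamma 6%N = F H.
  rewrite (H3i 0); congr F; apply/seteqP; split => [_ [p Hp <-]|p Hp].
    by rewrite add0r.
  by exists p => //; rewrite add0r.
rewrite -HE; exact: (rescaled_limit Omega_neq0 Omega_open (bounded_bnd Omega_bounded)
  Omega_lip F_ge0 H1 alpha_gt0 H2 gammaE H_hex H_area H3i H3ii).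
Qed.
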